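(* Let $(M,g)$ be a Riemannian manifold with local model $(V,h)$. Every faithful spinor bundle $\Sigma\to M$ is isomorphic to the bundle associated, by the spinor (evaluation) representation $\theta:\mathrm{Lpin}(h)\to\mathrm{GL}(S)$, with an lpin structure on $M$; that is, there is an lpin structure $\mathrm{Lpin}(h)\to Q\to M$ on $(M,g)$ such that $\Sigma$ is isomorphic, as a spinor bundle, to $Q\times_\theta S$.
   Context: Manifolds and maps are smooth and finite-dimensional. A Riemannian manifold $(M,g)$ is connected, and $g$ is non-degenerate but not necessarily definite; $M$ need not be orientable. A local model is a quadratic space $(V,h)$ (real finite-dimensional $V$ with non-degenerate quadratic form $h$) isometric to every $(T_xM,g_x)$; $m=\dim M=\dim V\ge 1$, and $\nu(m)$ is the integer part of $\tfrac12(m+1)$. $\mathrm{Cl}(h)$ is the real Clifford algebra with $v^2=h(v)$; $\mathrm{Cl}^0(h)$ is its even subalgebra, $\alpha$ the automorphism extending $v\mapsto -v$. For $m=2n$ even, the Dirac representation is the faithful irreducible complex representation of $\mathrm{Cl}(h)$, of dimension $2^n$. For $m=2n-1$ odd, the Pauli representation is the faithful irreducible complex representation of $\mathrm{Cl}^0(h)$, of dimension $2^{n-1}$; it extends to two inequivalent representations $\sigma$, $\sigma\circ\alpha$ of $\mathrm{Cl}(h)$, and $\sigma\oplus\sigma\circ\alpha$ is the Cartan representation. $(S,V,h)$ denotes the spin space: $S$ is the $2^{\nu(m)}$-dimensional complex space of the Dirac ($m$ even) or Cartan ($m$ odd) representation, with $V$ identified with its image in $\mathrm{End}\,S$. The Lipschitz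 group is $\mathrm{Lpin}(h)=\{a\in\mathrm{GL}(S): aVa^{-1}=V\}$ and $\mathrm{Ad}:\mathrm{Lpin}(h)\to\mathrm{O}(h)$ is $\mathrm{Ad}(a)v=ava^{-1}$. $\mathrm{Cl}(g)=\bigcup_x\mathrm{Cl}(g_x)$ is the Clifford bundle. A faithful spinor bundle over $M$ is a complex vector bundle $\Sigma\to M$ with an injective homomorphism of bundles of algebras $\tau:\mathrm{Cl}(g)\to\mathrm{End}\,\Sigma$ such that, for every $x$, the representation $\tau_x$ of $\mathrm{Cl}(g_x)$ in $\Sigma_x$ is equivalent to the Dirac representation ($m$ even) or the Cartan representation ($m$ odd). An isomorphism of spinor bundles is an isomorphism of complex vector bundles over $\mathrm{id}_M$ intertwining the homomorphisms $\tau$. Let $P\to M$ be the $\mathrm{O}(h)$-bundle of orthonormal frames (isometries $V\to T_xM$). An lpin structure is a principal $\mathrm{Lpin}(h)$-bundle $Q\to M$ with a morphism $\chi:Q\to P$ over $M$ such that $\chi(qa)=\chi(q)\circ\mathrm{Ad}(a)$ for $q\in Q$, $a\in\mathrm{Lpin}(h)$. The associated bundle $Q\times_\theta S$ consists of classes $[(q,s)]=[(qa,a^{-1}s)]$ and is a spinor bundle via $\tau(v)[(q,s)]=[(q,\chi(q)^{-1}(v)s)]$ for $v\in T_xM$, $q\in Q_x$, $s\in S$. *)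

(* Defs.v *)
From HB Require Import structures.
From mathcomp Require Import all_boot all_order all_algebra.
From mathcomp Require Import all_classical all_reals all_analysis.
From mathcomp Require Import complex.
Import numFieldNormedType.Exports.
Import Order.TTheory GRing.Theory Num.Theory.

Set Implicit Arguments.
Unset Strict Implicit.
Unset Printing Implicit Defensive.

Local Open Scope classical_set_scope.
Local Open Scope ring_scope.
Local Open Scope quotient_scope.

(* Cl(V, q) is presented by generators and relations: the generators are the
   vectors of V, and the relations are those of a unital associative algebra
   over K, the linearity of V -> Cl(V, q), and v^2 = q(v). *)
Section CliffordTerms.
Variables (K : comNzRingType) (V : lmodType K).

Inductive clterm : Type :=
  | CVec of V
  | CScal of K
  | CAdd of clterm & clterm
  | CMul of clterm & clterm.

Inductive clrel (q : V -> K) : clterm -> clterm -> Prop :=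
  | clrel_refl a : clrel q a a
  | clrel_sym a b : clrel q a b -> clrel q b a
  | clrel_trans a b c : clrel q a b -> clrel q b c -> clrel q a c
  | clrel_add a a' b b' :
      clrel q a a' -> clrel q b b' -> clrel q (CAdd a b) (CAdd a' b')
  | clrel_mul a a' b b' :
      clrel q a a' -> clrel q b b' -> clrel q (CMul a b) (CMul a' b')
  | clrel_addA a b c : clrel q (CAdd a (CAdd b c)) (CAdd (CAdd a b) c)
  | clrel_addC a b : clrel q (CAdd a b) (CAdd b a)
  | clrel_add0 a : clrel q (CAdd (CScal 0) a) a
  | clrel_mulA a b c : clrel q (CMul a (CMul b c)) (CMul (CMul a b) c)
  | clrel_mulDl a b c :
      clrel q (CMul (CAdd a b) c) (CAdd (CMul a c) (CMul b c))
  | clrel_mulDr a b c :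
      clrel q (CMul a (CAdd b c)) (CAdd (CMul a b) (CMul a c))
  | clrel_mul0 a : clrel q (CMul (CScal 0) a) (CScal 0)
  | clrel_mul1 a : clrel q (CMul (CScal 1) a) a
  | clrel_scalC r a : clrel q (CMul (CScal r) a) (CMul a (CScal r))
  | clrel_scalD r s : clrel q (CScal (r + s)) (CAdd (CScal r) (CScal s))
  | clrel_scalM r s : clrel q (CScal (r * s)) (CMul (CScal r) (CScal s))
  | clrel_vecD u v : clrel q (CVec (u + v)) (CAdd (CVec u) (CVec v))
  | clrel_vecZ r v : clrel q (CVec (r *: v)) (CMul (CScal r) (CVec v))
  | clrel_sq v : clrel q (CMul (CVec v) (CVec v)) (CScal (q v)).

HB.instance Definition _ := gen_eqMixin clterm.
HB.instance Definition _ := gen_choiceMixin clterm.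

Variable q : V -> K.

Definition clrelb (a b : clterm) : bool := `[< clrel q a b >].

Lemma clrelb_refl : reflexive clrelb.
Proof. by move=> a; apply/asboolP; exact: clrel_refl. Qed.

Lemma clrelb_sym : symmetric clrelb.
Proof. by move=> a b; apply/asboolP/asboolP; exact: clrel_sym. Qed.

Lemma clrelb_trans : transitive clrelb.
Proof. by move=> b a c /asboolP ab /asboolP bc; apply/asboolP; exact: clrel_trans ab bc. Qed.

Canonical clrel_equiv := EquivRel clrelb clrelb_refl clrelb_sym clrelb_trans.

Definition cl := {eq_quot clrel_equiv}.

HB.instance Definition _ := Choice.on cl.

Definition clcls (a : clterm) : cl := \pi_cl a.

Lemma clclsP a b : clrel q a b <-> clcls a = clcls b.
Proof.
split; first by move=> ab; apply/eqquotP/asboolP.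
by move/eqquotP/asboolP.
Qed.

Lemma clclsK (a : cl) : clcls (repr a) = a.
Proof. exact: reprK. Qed.

Lemma clrel_repr a : clrel q (repr (clcls a)) a.
Proof. by apply/clclsP; rewrite clclsK. Qed.

Definition cl_add (a b : cl) : cl := clcls (CAdd (repr a) (repr b)).
Definition cl_mul (a b : cl) : cl := clcls (CMul (repr a) (repr b)).
Definition cl_opp (a : cl) : cl := clcls (CMul (CScal (-1)) (repr a)).
Definition cl_scale (r : K) (a : cl) : cl := clcls (CMul (CScal r) (repr a)).

Lemma clclsD a b : clcls (CAdd a b) = cl_add (clcls a) (clcls b).
Proof. by apply/clclsP/clrel_add; apply/clrel_sym/clrel_repr. Qed.

Lemma clclsM a b : clcls (CMul a b) = cl_mul (clcls a) (clcls b).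
Proof. by apply/clclsP/clrel_mul; apply/clrel_sym/clrel_repr. Qed.

Lemma cl_oppE a : cl_opp (clcls a) = clcls (CMul (CScal (-1)) a).
Proof. by rewrite /cl_opp !clclsM clclsK. Qed.

Lemma cl_scaleE r a : cl_scale r (clcls a) = clcls (CMul (CScal r) a).
Proof. by rewrite /cl_scale !clclsM clclsK. Qed.

Lemma cl_ex (a : cl) : exists t, a = clcls t.
Proof. by exists (repr a); rewrite clclsK. Qed.

Local Ltac cl_terms :=
  repeat match goal with
  | |- forall x : cl, _ => let t := fresh "t" in
      let E := fresh in intro x; case: (cl_ex x) => t E; rewrite {x}E
  | |- _ => intro
  end.

Local Ltac cl_rel :=
  rewrite ?cl_oppE ?cl_scaleE -?clclsD -?clclsM ?cl_scaleE -?clclsD -?clclsM;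
  apply/clclsP.

Fact cl_addA : associative cl_add.
Proof. by rewrite /associative; cl_terms; cl_rel; exact: clrel_addA. Qed.
Fact cl_addC : commutative cl_add.
Proof. by rewrite /commutative; cl_terms; cl_rel; exact: clrel_addC. Qed.
Fact cl_add0 : left_id (clcls (CScal 0)) cl_add.
Proof. by rewrite /left_id; cl_terms; cl_rel; exact: clrel_add0. Qed.
Fact cl_mulA : associative cl_mul.
Proof. by rewrite /associative; cl_terms; cl_rel; exact: clrel_mulA. Qed.
Fact cl_mul1 : left_id (clcls (CScal 1)) cl_mul.
Proof. by rewrite /left_id; cl_terms; cl_rel; exact: clrel_mul1. Qed.
Fact cl_mulr1 : right_id (clcls (CScal 1)) cl_mul.
Proof.
rewrite /right_id; cl_terms; cl_rel.
by apply: clrel_trans (clrel_sym (clrel_scalC _ _ _)) _; exact: clrel_mul1.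
Qed.
Fact cl_mulDl : left_distributive cl_mul cl_add.
Proof. by rewrite /left_distributive; cl_terms; rewrite -clclsD -!clclsM -clclsD; apply/clclsP;
   exact: clrel_mulDl. Qed.
Fact cl_mulDr : right_distributive cl_mul cl_add.
Proof. by rewrite /right_distributive; cl_terms; rewrite -clclsD -!clclsM -clclsD; apply/clclsP;
   exact: clrel_mulDr. Qed.
Fact cl_addN : left_inverse (clcls (CScal 0)) cl_opp cl_add.
Proof.
rewrite /left_inverse; cl_terms; cl_rel.
apply: (@clrel_trans _ _ (CAdd (CMul (CScal (-1)) t) (CMul (CScal 1) t))).
  by apply: clrel_add; [exact: clrel_refl|exact/clrel_sym/clrel_mul1].
apply: clrel_trans (clrel_sym (clrel_mulDl _ _ _ _)) _.
apply: clrel_trans (clrel_mul0 _ t); apply: clrel_mul; last exact: clrel_refl.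
by have := clrel_sym (clrel_scalD q (-1) 1); rewrite addNr.
Qed.

HB.instance Definition _ :=
  GRing.isPzRing.Build cl cl_addA cl_addC cl_add0 cl_addN
    cl_mulA cl_mul1 cl_mulr1 cl_mulDl cl_mulDr.

Fact cl_scaleA r s a : cl_scale r (cl_scale s a) = cl_scale (r * s) a.
Proof.
case: (cl_ex a) => t ->; rewrite !cl_scaleE; apply/clclsP.
apply: clrel_trans (clrel_mulA _ _ _ _) _.
by apply: clrel_mul; [exact/clrel_sym/clrel_scalM|exact: clrel_refl].
Qed.
Fact cl_scale1 : left_id 1 cl_scale.
Proof. by rewrite /left_id; cl_terms; cl_rel; exact: clrel_mul1. Qed.
Fact cl_scaleDr : right_distributive cl_scale +%R.
Proof.
move=> r a b; case: (cl_ex a) => t ->; case: (cl_ex b) => u ->.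
rewrite -[clcls t + _]clclsD !cl_scaleE -[_ + _]clclsD.
by apply/clclsP; exact: clrel_mulDr.
Qed.
Fact cl_scaleDl a : {morph cl_scale^~ a : r s / r + s}.
Proof.
move=> r s; case: (cl_ex a) => t ->.
rewrite !cl_scaleE -[_ + clcls _]clclsD; apply/clclsP.
apply: clrel_trans (clrel_mulDl _ _ _ _).
by apply: clrel_mul; [exact: clrel_scalD|exact: clrel_refl].
Qed.

HB.instance Definition _ :=
  GRing.Zmodule_isLmodule.Build K cl cl_scaleA cl_scale1 cl_scaleDr cl_scaleDl.

Definition clvec (v : V) : cl := clcls (CVec v).

End CliffordTerms.

Arguments CScal {K V} _.
Arguments cl {K V} q.
Arguments clcls {K V} q a.
Arguments clvec {K V} q v.

Section CliffordFacts.
Variables (K : comNzRingType) (V : lmodType K) (q : V -> K).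

Lemma cl_scalE (r : K) : clcls q (CScal r) = r *: (1 : cl q).
Proof.
rewrite [RHS]cl_scaleE; apply/clclsP/clrel_sym.
by apply: clrel_trans (clrel_scalC _ _ _) _; exact: clrel_mul1.
Qed.

Lemma clvec_linear : linear (clvec q).
Proof.
move=> r u v; rewrite [r *: clvec q u]cl_scaleE -[_ + clvec q v]clclsD; apply/clclsP.
apply: clrel_trans (clrel_vecD _ _ _) _.
by apply: clrel_add; [exact: clrel_vecZ|exact: clrel_refl].
Qed.

Lemma clvec_sq v : clvec q v * clvec q v = q v *: (1 : cl q).
Proof. by rewrite -cl_scalE -[_ * _]clclsM; apply/clclsP; exact: clrel_sq. Qed.

Lemma cl_scaleAl (r : K) (a b : cl q) : r *: (a * b) = (r *: a) * b.
Proof.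
case: (cl_ex a) => t ->; case: (cl_ex b) => u ->.
rewrite -[_ * _]clclsM [LHS]cl_scaleE [r *: _]cl_scaleE -[RHS]clclsM.
by apply/clclsP; exact: clrel_mulA.
Qed.

Lemma cl_scaleAr (r : K) (a b : cl q) : r *: (a * b) = a * (r *: b).
Proof.
have scal c : r *: c = clcls q (CScal r) * c :> cl q.
  by case: (cl_ex c) => t ->; rewrite [LHS]cl_scaleE -[RHS]clclsM.
have comm c : clcls q (CScal r) * c = c * clcls q (CScal r).
  by case: (cl_ex c) => t ->; rewrite -![_ * _]clclsM;
     apply/clclsP; exact: clrel_scalC.
by rewrite !scal mulrA comm -mulrA.
Qed.

Lemma cl_ind (P : cl q -> Prop) :
  (forall v, P (clvec q v)) -> (forall r : K, P (r *: (1 : cl q))) ->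
  (forall a b, P a -> P b -> P (a + b)) ->
  (forall a b, P a -> P b -> P (a * b)) -> forall a, P a.
Proof.
move=> Pv Ps PD PM a; case: (cl_ex a) => t ->.
elim: t => [v|r|t IHt u IHu|t IHt u IHu]; first exact: Pv.
- by rewrite cl_scalE.
- by rewrite clclsD; exact: PD.
- by rewrite clclsM; exact: PM.
Qed.

(* The extension of f : V -> A to Cl(V, q), where A is a ring made into a
   K-algebra by a central k : K -> A. It is meaningful when f is linear and
   satisfies f(v)^2 = q(v): see clift_morph. *)
Section Lift.
Variables (A : pzRingType) (k : K -> A) (f : V -> A).

Fixpoint cleval (t : clterm V) : A :=
  match t with
  | CVec v => f v
  | CScal r => k r
  | CAdd t u => cleval t + cleval u
  | CMul t u => cleval t * cleval u
  end.

Definition clift (a : cl q) : A := cleval (repr a).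

Hypotheses (k0 : k 0 = 0) (k1 : k 1 = 1) (kD : {morph k : r s / r + s}).
Hypotheses (kM : {morph k : r s / r * s}) (kC : forall r x, k r * x = x * k r).
Hypotheses (fD : {morph f : u v / u + v}).
Hypotheses (fZ : forall r v, f (r *: v) = k r * f v).
Hypotheses (fsq : forall v, f v * f v = k (q v)).

Lemma cleval_rel t u : clrel q t u -> cleval t = cleval u.
Proof.
elim=> //=; first by move=> a b c _ -> _.
- by move=> a a' b b' _ -> _ ->.
- by move=> a a' b b' _ -> _ ->.
- by move=> *; rewrite addrA.
- by move=> *; rewrite addrC.
- by move=> *; rewrite k0 add0r.
- by move=> *; rewrite mulrA.
- by move=> *; rewrite mulrDl.
- by move=> *; rewrite mulrDr.
- by move=> *; rewrite k0 mul0r.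
- by move=> *; rewrite k1 mul1r.
Qed.

Lemma cliftE t : clift (clcls q t) = cleval t.
Proof. exact/cleval_rel/clrel_repr. Qed.

Lemma clift_vec v : clift (clvec q v) = f v.
Proof. exact: cliftE. Qed.

Lemma clift_morph :
  [/\ forall v, clift (clvec q v) = f v,
      {morph clift : a b / a + b}, {morph clift : a b / a * b},
      clift 1 = 1 & forall (r : K) a, clift (r *: a) = k r * clift a].
Proof.
split.
- exact: clift_vec.
- move=> a b; case: (cl_ex a) => t ->; case: (cl_ex b) => u ->.
  by rewrite -[_ + _]clclsD !cliftE.
- move=> a b; case: (cl_ex a) => t ->; case: (cl_ex b) => u ->.
  by rewrite -[_ * _]clclsM !cliftE.
- by rewrite [LHS]cliftE /= k1.
- by move=> r a; case: (cl_ex a) => t ->; rewrite [_ *: _]cl_scaleE !cliftE.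
Qed.

End Lift.
End CliffordFacts.

(* The algebra morphism induced by a linear f : V -> W with q' \o f = q. *)
Definition clmap (K : comNzRingType) (V W : lmodType K) (q : V -> K)
    (q' : W -> K) (f : V -> W) : cl q -> cl q' :=
  clift (fun r : K => r *: (1 : cl q')) (fun v => clvec q' (f v)).

Arguments clmap {K V W} q q' f.

Lemma clmap_vec (K : comNzRingType) (V W : lmodType K) (q : V -> K)
    (q' : W -> K) (f : V -> W) :
  linear f -> (forall v, q' (f v) = q v) ->
  forall v, clmap q q' f (clvec q v) = clvec q' (f v).
Proof.
move=> flin fq v; have flin' : forall r u w, f (r *: u + w) = r *: f u + f w.
  by move=> *; exact: flin.
have f0 : f 0 = 0.
  have := flin' 1 0 0; rewrite !scale1r addr0 => /eqP.
  by rewrite -subr_eq0 opprD addNKr oppr_eq0 => /eqP.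
have vlin := clvec_linear q'.
have v0 : clvec q' 0 = 0.
  have := vlin 1 0 0; rewrite /= !scale1r addr0 => /eqP.
  by rewrite -subr_eq0 opprD addNKr oppr_eq0 => /eqP.
apply: clift_vec.
- by rewrite scale0r.
- by rewrite scale1r.
- by move=> r s; rewrite scalerDl.
- by move=> r s; rewrite -cl_scaleAl mul1r scalerA.
- by move=> r x; rewrite -cl_scaleAl -cl_scaleAr mul1r mulr1.
- move=> u w; rewrite -[u in LHS]scale1r flin' scale1r.
  by rewrite -[f u in LHS]scale1r vlin scale1r.
- move=> r u; rewrite -[r *: u]addr0 flin' f0 vlin v0 addr0.
  by rewrite -cl_scaleAl mul1r.
- by move=> u; rewrite clvec_sq fq.
Qed.

Section EvenPart.
Variables (K : comNzRingType) (V : lmodType K) (q : V -> K).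

Definition clalpha : cl q -> cl q := clmap q q -%R.

(* the +1 eigenspace of the grading automorphism *)
Definition cl_even : set (cl q) := [set a | clalpha a = a].

End EvenPart.

Definition bilinear_form (K : comNzRingType) (V : lmodType K)
    (b : V -> V -> K) : Prop :=
  (forall u, scalar (b u)) /\ (forall v, scalar (b^~ v)).

Definition polar (K : comNzRingType) (V : lmodType K) (h : V -> K) (u v : V) :=
  h (u + v) - h u - h v.

Definition nondeg_quadform (K : comNzRingType) (V : lmodType K)
    (h : V -> K) : Prop :=
  [/\ forall a v, h (a *: v) = a ^+ 2 * h v, bilinear_form (polar h) &
      forall u, (forall v, polar h u v = 0) -> u = 0].

Definition is_isometry (K : comNzRingType) (V W : lmodType K) (q : V -> K)
    (q' : W -> K) (f : V -> W) : Prop :=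
  [/\ linear f, bijective f & forall v, q' (f v) = q v].

Section Representations.
Variables (R : realType) (V : lmodType R) (q : V -> R).

Definition cl_rep (S : lmodType R[i]) (rho : cl q -> S -> S) : Prop :=
  [/\ forall a, linear (rho a),
      forall a b s, rho (a + b) s = rho a s + rho b s,
      forall (r : R) a s, rho (r *: a) s = r%:C%C *: rho a s,
      forall s, rho 1 s = s &
      forall a b s, rho (a * b) s = rho a (rho b s)].

Definition faithful_on (D : set (cl q)) (S : lmodType R[i])
    (rho : cl q -> S -> S) : Prop :=
  forall a b, D a -> D b -> rho a = rho b -> a = b.

Definition subspace (S : lmodType R[i]) (T : set S) : Prop :=
  T 0 /\ forall (c : R[i]) s t, T s -> T t -> T (c *: s + t).

Definition irreducible_on (D : set (cl q)) (S : lmodType R[i])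
    (rho : cl q -> S -> S) : Prop :=
  (exists s : S, s != 0) /\
  forall T : set S, subspace T -> (forall a s, D a -> T s -> T (rho a s)) ->
    T = [set 0] \/ T = setT.

Definition dirac_rep (S : lmodType R[i]) (rho : cl q -> S -> S) : Prop :=
  [/\ cl_rep rho, faithful_on setT rho & irreducible_on setT rho].

(* sigma is an extension to Cl(q) of the Pauli representation of Cl^0(q) *)
Definition pauli_extension (S : lmodType R[i]) (sigma : cl q -> S -> S) : Prop :=
  [/\ cl_rep sigma, faithful_on (@cl_even _ _ q) sigma &
      irreducible_on (@cl_even _ _ q) sigma].

Definition cartan_rep (S : lmodType R[i]) (rho : cl q -> S -> S) : Prop :=
  cl_rep rho /\
  exists (S0 : lmodType R[i]) (sigma : cl q -> S0 -> S0) (J : S0 * S0 -> S),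
    [/\ pauli_extension sigma, linear J, bijective J &
        forall a s t, J (sigma a s, sigma (clalpha a) t) = rho a (J (s, t))].

Definition dirac_or_cartan (m : nat) (S : lmodType R[i])
    (rho : cl q -> S -> S) : Prop :=
  if odd m then cartan_rep rho else dirac_rep rho.

Definition spin_space (m : nat) (S : vectType R[i])
    (rho : cl q -> S -> S) : Prop :=
  dirac_or_cartan m rho /\ \dim {:S}%VS = (2 ^ m.+1./2)%N.

End Representations.

Section Lpin.
Variables (R : realType) (V : lmodType R) (h : V -> R).
Variables (S : vectType R[i]) (rho : cl h -> S -> S).

Definition conj_vec (a : 'End(S)) (v : V) : S -> S :=
  fun s => a (rho (clvec h v) (a^-1%VF s)).

Definition is_lpin (a : 'End(S)) : Prop :=
  lker a == 0%VS /\ range (conj_vec a) = range (fun v => rho (clvec h v)).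

Record lpin := Lpin { lpin_val : 'End(S); lpin_subproof : `[< is_lpin lpin_val >] }.

HB.instance Definition _ := [isSub for lpin_val].
HB.instance Definition _ := [Choice of lpin by <:].

Lemma lpinP (a : lpin) : is_lpin (lpin_val a).
Proof. exact/asboolP/lpin_subproof. Qed.

Lemma lker0_invf (a : 'End(S)) : lker a == 0%VS -> lker (a^-1)%VF == 0%VS.
Proof.
move=> a0; apply/lker0P => s t.
by move/(congr1 a); rewrite !lker0_lfunVK.
Qed.

Lemma is_lpin1 : is_lpin \1%VF.
Proof.
have k1 : lker (\1%VF : 'End(S)) == 0%VS by apply/lker0P => s t; rewrite !id_lfunE.
split=> //; suff -> : conj_vec \1%VF = (fun v => rho (clvec h v)) by [].
apply/funext => v; apply/funext => s.
rewrite /conj_vec id_lfunE; congr (rho _ _).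
by have := lker0_lfunVK k1 s; rewrite id_lfunE.
Qed.

Lemma lfunV_comp (a b : 'End(S)) s : lker a == 0%VS -> lker b == 0%VS ->
  ((a \o b)^-1)%VF s = (b^-1)%VF ((a^-1)%VF s).
Proof.
move=> a0 b0.
have ab0 : lker (a \o b)%VF == 0%VS.
  by apply/lker0P => u v; rewrite !comp_lfunE => /(lker0P a0)/(lker0P b0).
apply: (lker0P ab0); rewrite lker0_lfunVK //.
by rewrite comp_lfunE !lker0_lfunVK.
Qed.

Lemma is_lpin_conj a v : is_lpin a ->
  exists w, forall s, rho (clvec h w) s = a (rho (clvec h v) ((a^-1)%VF s)).
Proof.
case=> _ aV; have : range (conj_vec a) (conj_vec a v) by exists v.
by rewrite aV => -[w _ wE]; exists w => s; rewrite wE.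
Qed.

Lemma is_lpin_conjV a v : is_lpin a ->
  exists w, forall s, a (rho (clvec h w) ((a^-1)%VF s)) = rho (clvec h v) s.
Proof.
case=> _ aV; have : range (fun v => rho (clvec h v)) (rho (clvec h v)).
  by exists v.
by rewrite -aV => -[w _ wE]; exists w => s; rewrite -wE.
Qed.

Lemma is_lpinI (a : 'End(S)) : lker a == 0%VS ->
  (forall v, exists w, forall s,
    rho (clvec h w) s = a (rho (clvec h v) ((a^-1)%VF s))) ->
  (forall v, exists w, forall s,
    a (rho (clvec h w) ((a^-1)%VF s)) = rho (clvec h v) s) ->
  is_lpin a.
Proof.
move=> a0 aV Va; split=> //; apply/seteqP; split=> _ [v _ <-].
- by have [w wE] := aV v; exists w; [exact: I|exact/funext].
- by have [w wE] := Va v; exists w; [exact: I|exact/funext].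
Qed.

Lemma is_lpinM (a b : 'End(S)) : is_lpin a -> is_lpin b -> is_lpin (a \o b)%VF.
Proof.
move=> La Lb; have [a0 _] := La; have [b0 _] := Lb.
apply: is_lpinI => [|v|v].
- by apply/lker0P => u v; rewrite !comp_lfunE => /(lker0P a0)/(lker0P b0).
- have [w wE] := is_lpin_conj v Lb; have [u uE] := is_lpin_conj w La.
  by exists u => s; rewrite uE wE comp_lfunE lfunV_comp.
- have [w wE] := is_lpin_conjV v La; have [u uE] := is_lpin_conjV w Lb.
  by exists u => s; rewrite comp_lfunE lfunV_comp// uE wE.
Qed.

Lemma is_lpinV (a : 'End(S)) : is_lpin a -> is_lpin (a^-1)%VF.
Proof.
move=> La; have [a0 _] := La; have a0' := lker0_invf a0.
have aVV s : ((a^-1)^-1)%VF s = a s.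
  by apply: (lker0P a0'); rewrite lker0_lfunVK// lker0_lfunK.
apply: is_lpinI => // v.
- have [w wE] := is_lpin_conjV v La; exists w => s.
  by rewrite aVV -wE !lker0_lfunK.
- have [w wE] := is_lpin_conj v La; exists w => s.
  by rewrite aVV wE !lker0_lfunK.
Qed.

Definition lpin_one : lpin := Lpin (asboolT is_lpin1).
Definition lpin_mul (a b : lpin) : lpin :=
  Lpin (asboolT (is_lpinM (lpinP a) (lpinP b))).
Definition lpin_inv (a : lpin) : lpin := Lpin (asboolT (is_lpinV (lpinP a))).

Fact lpin_mulA : associative lpin_mul.
Proof. by move=> a b c; apply/val_inj/comp_lfunA. Qed.
Fact lpin_mul1 : left_id lpin_one lpin_mul.
Proof. by move=> a; apply/val_inj/comp_lfun1l. Qed.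
Fact lpin_mulr1 : right_id lpin_one lpin_mul.
Proof. by move=> a; apply/val_inj/comp_lfun1r. Qed.
Fact lpin_mulV : left_inverse lpin_one lpin_inv lpin_mul.
Proof. by move=> a; apply/val_inj/lker0_compVf; have [] := lpinP a. Qed.
Fact lpin_mulrV : right_inverse lpin_one lpin_inv lpin_mul.
Proof. by move=> a; apply/val_inj/lker0_compfV; have [] := lpinP a. Qed.

HB.instance Definition _ :=
  isGroup.Build lpin lpin_mulA lpin_mul1 lpin_mulr1 lpin_mulV lpin_mulrV.

Definition Ad (a : lpin) (v : V) : V :=
  xget 0 [set w | rho (clvec h w) = conj_vec (lpin_val a) v].

Lemma AdP a v : rho (clvec h (Ad a v)) = conj_vec (lpin_val a) v.
Proof.
have [_ aV] := lpinP a.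
have : range (conj_vec (lpin_val a)) (conj_vec (lpin_val a) v) by exists v.
rewrite aV => -[w _ wE].
exact: (xgetPex 0 (ex_intro [set w | rho (clvec h w) = _] w wE)).
Qed.

End Lpin.

Section Smooth.
Variables (R : realType) (E W : normedModType R).

(* Meant for open U; iterated Frechet derivatives are tested on fixed vectors,
   which is enough in finite dimension. *)
Fixpoint Ck_on (k : nat) (U : set E) (f : E -> W) : Prop :=
  match k with
  | 0%N => forall x, U x -> {for x, continuous f}
  | k'.+1 => (forall x, U x -> differentiable f x) /\
             forall v, Ck_on k' U (fun x => 'd f x v)
  end.

Definition smooth_on (U : set E) (f : E -> W) : Prop := forall k, Ck_on k U f.

End Smooth.

Record manifold (R : realType) (m : nat) := Manifold {
  mcarrier :> topologicalType;
  m_hausdorff : hausdorff_space mcarrier;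
  m_second_countable : @second_countable mcarrier;
  chart : Type;
  cdom : chart -> set mcarrier;
  cmap : chart -> mcarrier -> 'rV[R]_m;
  cinv : chart -> 'rV[R]_m -> mcarrier;
  cdom_open : forall i, open (cdom i);
  cdom_cover : forall x, exists i, cdom i x;
  cimg_open : forall i, open (cmap i @` cdom i);
  cmapK : forall i x, cdom i x -> cinv i (cmap i x) = x;
  cmap_continuous : forall i x, cdom i x -> {for x, continuous (cmap i)};
  cinv_continuous : forall i x, cdom i x ->
    {for cmap i x, continuous (cinv i)};
  cmap_smooth : forall i j,
    smooth_on (cmap i @` (cdom i `&` cdom j)) (cmap j \o cinv i) }.

Arguments chart {R m} _.
Arguments cdom {R m M} i : rename.
Arguments cmap {R m M} i : rename.
Arguments cinv {R m M} i : rename.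

Section Tangent.
Variables (R : realType) (m : nat) (M : manifold R m).

Definition msmooth (W : normedModType R) (U : set M) (f : M -> W) : Prop :=
  forall i : chart M,
    smooth_on (cmap i @` (cdom i `&` U)) (f \o cinv i).

(* A tangent vector at x is the family of its coordinate representations in
   the charts around x, related by the differentials of the coordinate changes;
   the components at the charts not containing x are set to 0. *)
Definition tangent_family (x : M) (v : chart M -> 'rV[R]_m) : Prop :=
  (forall i, ~ cdom i x -> v i = 0) /\
  (forall i j, cdom i x -> cdom j x ->
     v j = 'd (cmap j \o cinv i) (cmap i x) (v i)).

Definition tangent_pred (x : M) : {pred (chart M -> 'rV[R]_m)} :=
  fun v => `[< tangent_family x v >].

Fact tangent_submod (x : M) : submod_closed (tangent_pred x).
Proof.
split.
  by apply/asboolP; split=> // i j _ _; rewrite /= linear0.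
move=> a u v /asboolP[u0 uD] /asboolP[v0 vD]; apply/asboolP.
have E k : (a *: u + v) k = a *: u k + v k by [].
split=> [i xi|i j xi xj]; rewrite !E; first by rewrite u0// v0// scaler0 addr0.
by rewrite (uD _ _ xi xj) (vD _ _ xi xj) linearP.
Qed.

HB.instance Definition _ (x : M) :=
  GRing.isSubmodClosed.Build R (chart M -> 'rV[R]_m) (tangent_pred x)
    (tangent_submod x).

Record tangent (x : M) :=
  Tangent { tvec : chart M -> 'rV[R]_m; tvec_subproof : tvec \in tangent_pred x }.

HB.instance Definition _ (x : M) := [isSub for @tvec x].
HB.instance Definition _ (x : M) := [Choice of tangent x by <:].
HB.instance Definition _ (x : M) := [SubChoice_isSubLmodule of tangent x by <:].

Definition vfield := forall x : M, tangent x.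

Definition smooth_vfield (U : set M) (X : vfield) : Prop :=
  forall i : chart M, msmooth (U `&` cdom i) (fun x => tvec (X x) i).

Record metric := Metric {
  gform :> forall x : M, tangent x -> tangent x -> R;
  g_bilinear : forall x, bilinear_form (@gform x);
  g_sym : forall x u v, @gform x u v = @gform x v u;
  g_nondeg : forall x u, (forall v, @gform x u v = 0) -> u = 0;
  g_smooth : forall (U : set M) (X Y : vfield), open U ->
    smooth_vfield U X -> smooth_vfield U Y ->
    msmooth U (fun x => gform (X x) (Y x) : R^o) }.

Definition gquad (g : metric) (x : M) (v : tangent x) : R := g x v v.

Section CliffordBundle.
Variable g : metric.

(* The smooth local sections of Cl(g) are those which can locally be expressed
   as sums of products of smooth functions and smooth vector fields. *)
Inductive smooth_clsection :
    set M -> (forall x : M, cl (@gquad g x)) -> Prop :=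
  | clsection_vec (U : set M) (X : vfield) : smooth_vfield U X ->
      smooth_clsection U (fun x => clvec (@gquad g x) (X x))
  | clsection_scal (U : set M) (f : M -> R^o) : msmooth U f ->
      smooth_clsection U (fun x => (f x : R) *: (1 : cl (@gquad g x)))
  | clsection_add (U : set M) a b :
      smooth_clsection U a -> smooth_clsection U b ->
      smooth_clsection U (fun x => a x + b x)
  | clsection_mul (U : set M) a b :
      smooth_clsection U a -> smooth_clsection U b ->
      smooth_clsection U (fun x => a x * b x)
  | clsection_local (U : set M) (N : M -> set M) a b :
      (forall x, U x -> [/\ open (N x), N x x & N x `<=` U]) ->
      (forall x, U x -> smooth_clsection (N x) (b x)) ->
      (forall x y, U x -> N x y -> a y = b x y) ->
      smooth_clsection U a.

End CliffordBundle.
End Tangent.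

Arguments gquad {R m M} g x v.

Section VectorBundles.
Variables (R : realType) (m : nat) (M : manifold R m).

Definition csmooth (U : set M) (f : M -> R[i]) : Prop :=
  msmooth U (fun x => complex.Re (f x) : R^o) /\
  msmooth U (fun x => complex.Im (f x) : R^o).

(* Maps into a finite-dimensional complex vector space, resp. into a space of
   linear maps, are smooth when their matrix entries are. *)
Definition vsmooth (F : vectType R[i]) (U : set M) (f : M -> F) : Prop :=
  forall l : {scalar F}, csmooth U (fun x => l (f x)).

Definition hsmooth (F F' : vectType R[i]) (U : set M)
    (f : M -> 'Hom(F, F')) : Prop :=
  forall s : F, vsmooth U (fun x => f x s).

(* A smooth complex vector bundle with typical fibre F, given by its fibres and
   an atlas of local trivialisations with smooth transition functions; the atlas
   determines the topology and the smooth structure of the total space. *)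
Record cvbundle := CVBundle {
  typical : vectType R[i];
  fib :> M -> lmodType R[i];
  triv : Type;
  tdom : triv -> set M;
  tmap : triv -> forall x : M, fib x -> typical;
  tdom_open : forall i, open (tdom i);
  tdom_cover : forall x, exists i, tdom i x;
  tmap_linear : forall i x, tdom i x -> linear (@tmap i x);
  tmap_bij : forall i x, tdom i x -> bijective (@tmap i x);
  tmap_smooth : forall i j, exists2 c : M -> 'End(typical),
    hsmooth (tdom i `&` tdom j) c &
    forall x, tdom i x -> tdom j x ->
      forall s : fib x, tmap j s = c x (tmap i s) }.

Definition smooth_hom (U : set M) (B B' : cvbundle)
    (Phi : forall x : M, B x -> B' x) : Prop :=
  (forall x, U x -> linear (@Phi x)) /\
  forall (i : triv B) (j : triv B'), exists2 c : M -> 'Hom(typical B, typical B'),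
    hsmooth (U `&` tdom i `&` tdom j) c &
    forall x, U x -> tdom i x -> tdom j x ->
      forall s : B x, tmap j (Phi x s) = c x (tmap i s).

Variable g : metric M.

Record faithful_spinor_bundle := SpinorBundle {
  sbundle :> cvbundle;
  stau : forall x : M, cl (gquad g x) -> sbundle x -> sbundle x;
  stau_rep : forall x, cl_rep (@stau x);
  stau_inj : forall x, injective (@stau x);
  stau_smooth : forall (U : set M) (a : forall x, cl (gquad g x)), open U ->
    smooth_clsection U a -> smooth_hom U (fun x => stau (a x));
  stau_spin : forall x, dirac_or_cartan m (@stau x) }.

(* An isomorphism of spinor bundles only involves the underlying vector bundles
   and the actions of the fibres of Cl(g). *)
Definition cl_action (B : cvbundle) :=
  forall x : M, cl (gquad g x) -> B x -> B x.

Definition spinor_iso (B B' : cvbundle) (tau : cl_action B)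
    (tau' : cl_action B') : Prop :=
  exists (Phi : forall x, B x -> B' x) (Psi : forall x, B' x -> B x),
    [/\ smooth_hom setT Phi, smooth_hom setT Psi,
        forall x, cancel (Phi x) (Psi x), forall x, cancel (Psi x) (Phi x) &
        forall x a s, Phi x (tau x a s) = tau' x a (Phi x s)].

End VectorBundles.

Section PrincipalBundles.
Variables (R : realType) (m : nat) (M : manifold R m).
Variables (S : vectType R[i]) (G : groupType) (theta : G -> 'End(S)).

(* G is meant to be a Lie group embedded by theta as a closed subgroup of GL(S),
   so that a map into G is smooth if and only if it is smooth into End(S). *)
Definition gsmooth (U : set M) (c : M -> G) : Prop :=
  hsmooth U (fun x => theta (c x)).

(* A smooth principal (right) G-bundle, given by its fibres and an atlas of
   equivariant local trivialisations with smooth transition functions. *)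
Record principal_bundle := PrincipalBundle {
  pfib :> M -> choiceType;
  pact : forall x : M, pfib x -> G -> pfib x;
  ptriv : Type;
  pdom : ptriv -> set M;
  pmap : ptriv -> forall x : M, pfib x -> G;
  pact1 : forall x (p : pfib x), pact p 1%g = p;
  pactM : forall x (p : pfib x) a b, pact (pact p a) b = pact p (a * b)%g;
  pdom_open : forall i, open (pdom i);
  pdom_cover : forall x, exists i, pdom i x;
  pmap_bij : forall i x, pdom i x -> bijective (@pmap i x);
  pmap_act : forall i x (p : pfib x) a, pdom i x ->
    pmap i (pact p a) = (pmap i p * a)%g;
  pmap_smooth : forall i j, exists2 c : M -> G,
    gsmooth (pdom i `&` pdom j) c &
    forall x, pdom i x -> pdom j x ->
      forall p : pfib x, pmap j p = (c x * pmap i p)%g }.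

(* Local sections over U are represented by the restrictions to U of
   set-theoretic global sections. *)
Definition smooth_psection (Q : principal_bundle) (U : set M)
    (s : forall x, Q x) : Prop :=
  forall i : ptriv Q, exists2 c : M -> G,
    gsmooth (U `&` pdom i) c &
    forall x, U x -> pdom i x -> pmap i (s x) = c x.

Lemma pfib_ex (Q : principal_bundle) (x : M) : exists p : Q x, True.
Proof.
have [i xi] := pdom_cover Q x; have [f _ _] := pmap_bij xi.
by exists (f 1%g).
Qed.

Lemma pact_trans (Q : principal_bundle) (x : M) (p p' : Q x) :
  exists a, p' = pact p a.
Proof.
have [i xi] := pdom_cover Q x.
exists ((pmap i p)^-1 * pmap i p')%g; apply: (bij_inj (pmap_bij xi)).
by rewrite pmap_act// mulgA mulgV mul1g.
Qed.

Lemma pact_free (Q : principal_bundle) (x : M) (p : Q x) a b :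
  pact p a = pact p b -> a = b.
Proof.
have [i xi] := pdom_cover Q x.
by move/(congr1 (fun r => pmap i r)); rewrite !pmap_act// => /mulgI.
Qed.

End PrincipalBundles.

Section LpinStructures.
Variables (R : realType) (m : nat) (M : manifold R m) (g : metric M).
Variables (V : vectType R) (h : V -> R).
Variables (S : vectType R[i]) (rho : cl h -> S -> S).

Record oframe (x : M) := OFrame {
  frame :> V -> tangent x;
  frame_inv : tangent x -> V;
  frame_linear : linear frame;
  frameK : cancel frame frame_inv;
  frame_invK : cancel frame_inv frame;
  frame_isometric : forall v, gquad g x (frame v) = h v }.

Notation lpin_bundle :=
  (@principal_bundle R m M S (lpin rho) (@lpin_val _ _ _ _ rho)).

(* Smoothness of the equivariant map chi : Q -> P means that it maps smooth
   local sections of Q to smooth local frame fields. *)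
Record lpin_structure := LpinStructure {
  lbundle :> lpin_bundle;
  chi : forall x : M, lbundle x -> oframe x;
  chi_act : forall x (p : lbundle x) a v, chi (pact p a) v = chi p (Ad a v);
  chi_smooth : forall (U : set M) (s : forall x, lbundle x), open U ->
    smooth_psection U s ->
    forall v : V, smooth_vfield U (fun x => chi (s x) v) }.

Section Associated.
Variable Q : lpin_structure.

Definition assoc_rel (x : M) (c d : Q x * S) : Prop :=
  exists a : lpin rho, d = (pact c.1 a, (lpin_val a)^-1%VF c.2).

Definition assoc_relb (x : M) (c d : Q x * S) : bool := `[< assoc_rel c d >].

Lemma lpin_valK (a : lpin rho) : cancel (lpin_val a)^-1%VF (lpin_val a).
Proof. by have [a0 _] := lpinP a; move=> s; rewrite lker0_lfunVK. Qed.

Lemma lpin_valVK (a : lpin rho) : cancel (lpin_val a) (lpin_val a)^-1%VF.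
Proof. by have [a0 _] := lpinP a; move=> s; rewrite lker0_lfunK. Qed.

Lemma assoc_relb_refl x : reflexive (@assoc_relb x).
Proof.
move=> [p s]; apply/asboolP; exists 1%g; rewrite pact1; congr (_, _).
by rewrite -[X in _ = _ X](id_lfunE s) lpin_valVK.
Qed.

Lemma assoc_rel_sym x (c d : Q x * S) : assoc_rel c d -> assoc_rel d c.
Proof.
case: c d => [p s] _ [a ->]; exists (a^-1)%g; rewrite /= pactM mulgV pact1.
congr (_, _); apply: (can_inj (lpin_valVK (a^-1)%g)).
by rewrite lpin_valK.
Qed.

Lemma assoc_relb_sym x : symmetric (@assoc_relb x).
Proof. by move=> c d; apply/asboolP/asboolP; exact: assoc_rel_sym. Qed.

Lemma assoc_relb_trans x : transitive (@assoc_relb x).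
Proof.
move=> d c e /asboolP[a ->] /asboolP[b ->]; apply/asboolP.
exists (a * b)%g; rewrite /= pactM; congr (_, _).
have [[a0 _] [b0 _]] := (lpinP a, lpinP b).
by rewrite lfunV_comp.
Qed.

Canonical assoc_equiv (x : M) :=
  EquivRel (@assoc_relb x) (@assoc_relb_refl x) (@assoc_relb_sym x)
    (@assoc_relb_trans x).

Definition assoc_fib (x : M) := {eq_quot assoc_equiv x}.

HB.instance Definition _ (x : M) := Choice.on (assoc_fib x).

Definition assoc_cls (x : M) (p : Q x) (s : S) : assoc_fib x :=
  \pi_(assoc_fib x) (p, s).

Lemma assoc_clsP x (p p' : Q x) s s' :
  assoc_rel (p, s) (p', s') <-> assoc_cls p s = assoc_cls p' s'.
Proof.
split; first by move=> r; apply/eqquotP/asboolP.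
by move/eqquotP/asboolP.
Qed.

Lemma assoc_cls_act x (p : Q x) a s :
  assoc_cls (pact p a) s = assoc_cls p (lpin_val a s).
Proof. by apply/esym/assoc_clsP; exists a; rewrite /= lpin_valVK. Qed.

Lemma assoc_cls_repr x (c : assoc_fib x) : assoc_cls (repr c).1 (repr c).2 = c.
Proof. by rewrite /assoc_cls -surjective_pairing; exact: reprK. Qed.

Lemma assoc_cls_inj x (p : Q x) : injective (assoc_cls p).
Proof.
move=> s s' /assoc_clsP[a [pa ->]].
have a1 : a = 1%g.
  by apply: (@pact_free _ _ _ _ _ _ Q x p); rewrite pact1 -pa.
rewrite a1; apply: (can_inj (lpin_valVK 1%g)); rewrite lpin_valK.
exact: id_lfunE.
Qed.

Lemma assoc_cls_ex x (p : Q x) (c : assoc_fib x) : exists s, c = assoc_cls p s.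
Proof.
have [a pa] := pact_trans p (repr c).1.
exists (lpin_val a (repr c).2).
by rewrite -assoc_cls_act -pa assoc_cls_repr.
Qed.

Definition assoc_coord (x : M) (p : Q x) (c : assoc_fib x) : S :=
  xget 0 [set s | c = assoc_cls p s].

Lemma assoc_coordK x (p : Q x) c : assoc_cls p (assoc_coord p c) = c.
Proof.
have [s cs] := assoc_cls_ex p c.
exact/esym/(xgetPex 0 (ex_intro [set s | c = assoc_cls p s] s cs)).
Qed.

Lemma assoc_clsK x (p : Q x) s : assoc_coord p (assoc_cls p s) = s.
Proof. by apply: (@assoc_cls_inj _ p); rewrite assoc_coordK. Qed.

Definition base_point (x : M) : Q x := sval (cid (pfib_ex Q x)).

(* The vector space structure of the fibre makes every s |-> [(p, s)] linear:
   see assoc_cls_linear. *)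
Definition assoc_zero x : assoc_fib x := assoc_cls (base_point x) 0.
Definition assoc_opp x (c : assoc_fib x) : assoc_fib x :=
  assoc_cls (base_point x) (- assoc_coord (base_point x) c).
Definition assoc_add x (c d : assoc_fib x) : assoc_fib x :=
  assoc_cls (base_point x)
    (assoc_coord (base_point x) c + assoc_coord (base_point x) d).
Definition assoc_scale x (r : R[i]) (c : assoc_fib x) : assoc_fib x :=
  assoc_cls (base_point x) (r *: assoc_coord (base_point x) c).

Fact assoc_addA x : associative (@assoc_add x).
Proof. by move=> c d e; rewrite /assoc_add !assoc_clsK addrA. Qed.
Fact assoc_addC x : commutative (@assoc_add x).
Proof. by move=> c d; rewrite /assoc_add addrC. Qed.
Fact assoc_add0 x : left_id (@assoc_zero x) (@assoc_add x).
Proof. by move=> c; rewrite /assoc_add assoc_clsK add0r assoc_coordK. Qed.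
Fact assoc_addN x : left_inverse (@assoc_zero x) (@assoc_opp x) (@assoc_add x).
Proof. by move=> c; rewrite /assoc_add assoc_clsK addNr. Qed.

HB.instance Definition _ x := GRing.isZmodule.Build (assoc_fib x)
  (@assoc_addA x) (@assoc_addC x) (@assoc_add0 x) (@assoc_addN x).

Fact assoc_scaleA x a b (c : assoc_fib x) :
  assoc_scale a (assoc_scale b c) = assoc_scale (a * b) c.
Proof. by rewrite /assoc_scale assoc_clsK scalerA. Qed.
Fact assoc_scale1 x : left_id 1 (@assoc_scale x).
Proof. by move=> c; rewrite /assoc_scale scale1r assoc_coordK. Qed.
Fact assoc_scaleDr x : right_distributive (@assoc_scale x) +%R.
Proof.
by move=> a c d; rewrite /assoc_scale /GRing.add /= /assoc_add !assoc_clsK scalerDr.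
Qed.
Fact assoc_scaleDl x (c : assoc_fib x) : {morph (@assoc_scale x)^~ c : a b / a + b}.
Proof.
move=> a b; rewrite /assoc_scale [RHS]/GRing.add /= /assoc_add !assoc_clsK.
by rewrite scalerDl.
Qed.

HB.instance Definition _ x := GRing.Zmodule_isLmodule.Build R[i] (assoc_fib x)
  (@assoc_scaleA x) (@assoc_scale1 x) (@assoc_scaleDr x) (@assoc_scaleDl x).

Lemma assoc_cls_linear x (p : Q x) : linear (assoc_cls p).
Proof.
move=> r s t; have [a ->] := pact_trans (base_point x) p.
rewrite !assoc_cls_act linearP.
rewrite [RHS]/GRing.add /= /assoc_add /GRing.scale /= /assoc_scale.
by rewrite !assoc_clsK.
Qed.

(* [(p, s)] |-> theta(g) s, where g in Lpin(h) is the image of p under the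
   local trivialisation i of Q *)
Definition assoc_map (i : ptriv Q) (x : M) (c : assoc_fib x) : S :=
  lpin_val (pmap i (repr c).1) (repr c).2.

Lemma assoc_mapE i x (p : Q x) s :
  pdom i x -> assoc_map i (assoc_cls p s) = lpin_val (pmap i p) s.
Proof.
move=> xi; have /esym/assoc_clsP[a] := assoc_cls_repr (assoc_cls p s).
rewrite /assoc_map => -[-> ->]; rewrite /= pmap_act//=.
by rewrite comp_lfunE lpin_valK.
Qed.

Fact assoc_map_linear i x : pdom i x -> linear (@assoc_map i x).
Proof.
move=> xi r c d.
rewrite -(assoc_coordK (base_point x) c) -(assoc_coordK (base_point x) d).
by rewrite -assoc_cls_linear !assoc_mapE// linearP.
Qed.

Fact assoc_map_bij i x : pdom i x -> bijective (@assoc_map i x).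
Proof.
move=> xi.
exists (fun s => assoc_cls (base_point x) ((lpin_val (pmap i (base_point x)))^-1%VF s)).
  move=> c; rewrite -{1}(assoc_coordK (base_point x) c) assoc_mapE//.
  by rewrite lpin_valVK assoc_coordK.
by move=> s; rewrite assoc_mapE// lpin_valK.
Qed.

Fact assoc_map_smooth i j : exists2 c : M -> 'End(S),
  hsmooth (pdom i `&` pdom j) c &
  forall x, pdom i x -> pdom j x ->
    forall s : assoc_fib x, assoc_map j s = c x (assoc_map i s).
Proof.
have [c cs cE] := pmap_smooth i j; exists (fun x => lpin_val (c x)) => //.
move=> x xi xj s; rewrite -(assoc_coordK (base_point x) s) !assoc_mapE//.
by rewrite (cE x xi xj) /= comp_lfunE.
Qed.

Definition assoc_bundle : cvbundle M :=
  @CVBundle R m M S assoc_fib (ptriv Q) (@pdom _ _ _ _ _ _ Q) assoc_map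
    (@pdom_open _ _ _ _ _ _ Q) (@pdom_cover _ _ _ _ _ _ Q)
    assoc_map_linear assoc_map_bij assoc_map_smooth.

(* a . [(p, s)] = [(p, chi(p)^-1(a) s)], where chi(p)^-1 is extended to an
   isomorphism Cl(g_x) -> Cl(h): see assoc_tau_vec for the case of vectors. *)
Definition assoc_tau : cl_action g assoc_bundle :=
  fun x a c =>
    let: (p, s) := repr (c : assoc_fib x) in
    assoc_cls p (rho (clmap (gquad g x) h (frame_inv (chi p)) a) s).

Lemma assoc_tau_vec x (v : tangent x) (p : Q x) (s : S) :
  assoc_tau (clvec (gquad g x) v) (assoc_cls p s) =
  assoc_cls p (rho (clvec h (frame_inv (chi p) v)) s).
Proof.
have /esym/assoc_clsP[a] := assoc_cls_repr (assoc_cls p s).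
rewrite /assoc_tau; case: (repr _) => [p' s'] /= [-> ->].
set f := frame_inv _; have fK := frame_invK (chi (pact p a)).
rewrite clmap_vec; first last.
- by move=> w; rewrite -(frame_isometric (chi (pact p a))) fK.
- move=> r u w; apply: (can_inj (frameK (chi (pact p a)))).
  by rewrite fK frame_linear !fK.
rewrite assoc_cls_act; congr (assoc_cls p _).
have -> : frame_inv (chi p) v = Ad a (f v).
  by apply: (can_inj (frameK (chi p))); rewrite frame_invK -chi_act fK.
by rewrite AdP.
Qed.

End Associated.
End LpinStructures.

(* Main.v *)
Require Import Defs.
From mathcomp Require Import all_boot all_order all_algebra.
From mathcomp Require Import all_classical all_reals all_analysis.
From mathcomp Require Import complex.
Import numFieldNormedType.Exports.
From HB Require Import structures.
From mathcomp Require Import ring lra.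
Import Order.TTheory GRing.Theory Num.Theory.
Import VectorInternalTheory.

Set Implicit Arguments.
Unset Strict Implicit.
Unset Printing Implicit Defensive.

Local Open Scope classical_set_scope.
Local Open Scope ring_scope.

(** The fibre over x of the bundle Q to be constructed should consist of the
    spinor frames at x: the pairs of an isometry q from V to T_x M and a linear
    isomorphism phi from S to Sigma_x that intertwines the action of v on S with
    the action of q(v) on Sigma_x. The theorem then rests on three facts.

    Two spinor frames (q, phi) and (q', phi') at x differ by an element of the
    Lipschitz group: a = phi'^-1 phi conjugates v into q'^-1(q(v))
    ([spinor_frame_transition]).

    Spinor frames exist at every point ([spinor_equiv]). For an orthonormal
    basis e_i of V, the maps A |-> eps_i q(e_i) A e_i are commuting involutions
    of the linear maps between two Clifford modules, so some nonzero A satisfies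
    q(e_i) A = +-A e_i for all i. Composing A with a generator e_k reverses all
    signs except that of e_k; in this way the signs can be made equal, one
    generator at a time ([intertwiner_up_to_sign]). In even dimension the volume
    element anticommutes with all vectors and removes a common sign -1, and
    Schur's lemma applied to the two irreducible Dirac representations gives the
    isomorphism ([dirac_equiv]). In odd dimension the same argument applies to
    the two Pauli representations; a common sign -1 then means that A intertwines
    sigma with sigma' o alpha, so that exchanging the two summands of
    sigma' + sigma' o alpha yields an intertwiner of the Cartan representations
    ([cartan_equiv]).

    Spinor frames can be chosen smoothly near each point x0
    ([smooth_spinor_frame_exists]). The Gram-Schmidt process extends an
    orthonormal frame at x0 to a smooth one X_i ([orthonormal_frame]). In a local
    trivialisation of Sigma, the isomorphism phi at x0 is a linear map, regarded
    as a constant function of the point; averaging it successively over the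
    involutions A |-> eps_i X_i A e_i turns it into a smooth family of
    intertwiners. The value at x0 is not changed by the averaging, hence the
    family consists of isomorphisms near x0.

    The construction of Q is then formal. A spinor frame (q0, f0) chosen at each
    point, without any continuity, identifies the fibre of Q with the Lipschitz
    group, a corresponding to the frame f0 a. The local smooth frames phi_j give
    the trivialisations, with transition functions phi_j^-1 phi_i, which are
    smooth because the inverse of a matrix is a smooth function of its entries
    ([hsmooth_inv]). The isomorphism maps s in Sigma_x to the class of
    (f0, f0^-1 s). *)

(** * Linear maps *)

(** Linear maps mostly occur below as plain functions with a proof of linearity, such
    as the operators of a representation; these are their computation rules. *)
Section LinearFunctions.
Variables (K : pzRingType) (E E' : lmodType K) (f : E -> E').
Hypothesis flin : linear f.
Let fL : {linear E -> E'} := HB.pack f (GRing.isLinear.Build _ _ _ _ f flin).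
Lemma linfD u v : f (u + v) = f u + f v. Proof. exact: (linearD fL). Qed.
Lemma linfB u v : f (u - v) = f u - f v. Proof. exact: (linearB fL). Qed.
Lemma linfN u : f (- u) = - f u. Proof. exact: (linearN fL). Qed.
Lemma linfZ a u : f (a *: u) = a *: f u. Proof. exact: (linearZZ fL). Qed.
Lemma linf0 : f 0 = 0. Proof. exact: (linear0 fL). Qed.
Lemma linf_sum (I : Type) (r : seq I) (P : pred I) (F : I -> E) :
  f (\sum_(i <- r | P i) F i) = \sum_(i <- r | P i) f (F i).
Proof. exact: (linear_sum fL). Qed.
End LinearFunctions.

Lemma linear_comp (K : pzRingType) (E E' E'' : lmodType K) (f : E' -> E'')
  (g : E -> E') : linear f -> linear g -> linear (f \o g).
Proof. by move=> fl gl a u v; rewrite /= gl fl. Qed.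

Lemma inj_surj_bij (T T' : Type) (f : T -> T') :
  injective f -> (forall y, exists x, f x = y) -> bijective f.
Proof.
move=> fi /choice[k fk]; exists k => x //; exact/fi/fk.
Qed.

Lemma linear_inv (K : pzRingType) (E E' : lmodType K) (f : E -> E') (f' : E' -> E) :
  cancel f f' -> cancel f' f -> linear f -> linear f'.
Proof. by move=> fK f'K fl a u v; apply: (can_inj fK); rewrite f'K fl !f'K. Qed.

Lemma linear_linfunE (K : fieldType) (F F' : vectType K) (f : F -> F') :
  linear f -> linfun f =1 f.
Proof. by move=> fl; exact: (lfunE (HB.pack f (GRing.isLinear.Build _ _ _ _ f fl))). Qed.

(** The inverse [a^-1] is defined by a pseudo-inverse matrix, also for maps
    between different spaces; for a bijection it is the expected one. *)
Lemma inv_lfunP (K : fieldType) (F F' : vectType K) (a : 'Hom(F, F'))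
    (b : F' -> F) : cancel a b -> cancel b a -> a^-1%VF =1 b.
Proof.
move=> ab ba s; have a0 : lker a == 0%VS by apply/lker0P; exact: can_inj ab.
by apply: (can_inj ab); rewrite ba limg_lfunVK// -[s]ba memv_img// memvf.
Qed.

(** Functionals are the source of the rank one maps s |-> l(s) w from which
    intertwiners are built by averaging. *)
Lemma nonzero_functional (K : fieldType) (S : vectType K) (s : S) : s != 0 ->
  exists l : S -> K, linear (l : S -> K^o) /\ l s != 0.
Proof.
move=> s0; have : v2r s != 0 by rewrite -(inj_eq (can_inj r2vK)) v2rK linear0.
move=> /rV0Pn[i si]; exists (fun u => v2r u 0 i); split=> //.
by move=> a u v; rewrite linearP !mxE.
Qed.

(** * Smooth functions on normed spaces *)

Section Calculus.
Variable R : realType.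

(** The differential is chosen among the continuous linear maps that satisfy a
    remainder estimate. This estimate only involves the germ of the function, and
    it determines the linear map. *)
Lemma near_eq_diff (E W : normedModType R) (f g : E -> W) (x : E) :
  (\forall y \near x, f y = g y) -> differentiable f x ->
  differentiable g x /\ 'd g x = 'd f x :> (E -> W).
Proof.
move=> fg df.
have fgx : f x = g x := nbhs_singleton fg.
have [dc dE] : continuous ('d f x) /\
    g \o shift x = cst (g x) + 'd f x +o_ 0 id.
  split; first exact: diff_continuous.
  have /eqaddoP fo := diff_locally df.
  apply/eqaddoP => k k0; have := fo k k0.
  have : \forall h \near 0, f (h + x) = g (h + x).
    move: fg; rewrite (near_shift 0); apply: filterS => h.
    by rewrite /= subr0.
  by apply: filterS2 => h /= fgh; rewrite !fctE /= fgh fgx.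
have dgE := diff_unique dc dE; split=> //.
by apply/diff_locallyP; rewrite dgE.
Qed.

Lemma Ck_ext k (E W : normedModType R) (U : set E) (f g : E -> W) :
  open U -> (forall x, U x -> f x = g x) -> Ck_on k U f -> Ck_on k U g.
Proof.
move=> oU; elim: k f g => [|k IH] f g fg.
  move=> fc x Ux; rewrite /prop_for /continuous_at -(fg x Ux).
  apply: cvg_trans (fc x Ux); apply: near_eq_cvg.
  by apply: filterS (open_nbhs_nbhs (conj oU Ux)).
case=> df dC.
have N x : U x -> \forall y \near x, f y = g y.
  by move=> Ux; apply: filterS (open_nbhs_nbhs (conj oU Ux)).
split=> [x Ux|v]; first by have [] := near_eq_diff (N x Ux) (df x Ux).
apply: IH (dC v) => x Ux.
by have [_ ->] := near_eq_diff (N x Ux) (df x Ux).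
Qed.

Lemma Ck_sub k (E W : normedModType R) (U U' : set E) (f : E -> W) :
  U' `<=` U -> Ck_on k U f -> Ck_on k U' f.
Proof.
move=> UU; elim: k f => [|k IH] f; first by move=> fc x /UU/fc.
by case=> df dC; split=> [x /UU|v]; [exact: df|exact: IH (dC v)].
Qed.

(** Each condition in [Ck_on] is imposed separately at each point, so that the
    sets [U'] need not be open. *)
Lemma Ck_local k (E W : normedModType R) (U : set E) (f : E -> W) :
  (forall x, U x -> exists2 U', U' x & Ck_on k U' f) -> Ck_on k U f.
Proof.
elim: k f => [|k IH] f H; first by move=> x /H[U' U'x fc]; exact: fc.
split=> [x /H[U' U'x [dF _]]|v]; first exact: dF.
by apply: IH => x /H[U' U'x [_ fC]]; exists U'; last exact: fC.
Qed.

Lemma Ck_mono k (E W : normedModType R) (U : set E) (f : E -> W) :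
  Ck_on k.+1 U f -> Ck_on k U f.
Proof.
elim: k f => [|k IH] f [df dC].
  by move=> x /df; exact: differentiable_continuous.
by split=> // v; exact: IH.
Qed.

Lemma Ck_cst k (E W : normedModType R) (U : set E) (w : W) :
  Ck_on k U (fun _ => w).
Proof.
elim: k w => [|k IH] w; first by move=> x _; exact: cst_continuous.
split=> [x _|v]; first exact: differentiable_cst.
suff -> : (fun x => 'd (fun=> w) x v) = (fun=> 0) by exact: IH.
by apply/funext => x; rewrite diff_cst.
Qed.

Lemma Ck_add k (E W : normedModType R) (U : set E) (f g : E -> W) :
  open U -> Ck_on k U f -> Ck_on k U g -> Ck_on k U (fun x => f x + g x).
Proof.
move=> oU; elim: k f g => [|k IH] f g.
  by move=> fc gc x Ux; apply: continuousD; [exact: fc|exact: gc].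
case=> df fC [dg gC]; split=> [x Ux|v].
  by apply: (@differentiableD _ _ _ f g); [exact: df|exact: dg].
apply: (@Ck_ext k _ _ U (fun x => 'd f x v + 'd g x v)) (IH _ _ (fC v) (gC v)) => //.
move=> x Ux; have := @diffD _ _ _ f g x (df x Ux) (dg x Ux).
by move=> /(congr1 (@^~ v)).
Qed.

Lemma Ck_lin k (E W W' : normedModType R) (U : set E) (f : E -> W)
    (l : W -> W') :
  open U -> linear l -> continuous l -> Ck_on k U f -> Ck_on k U (l \o f).
Proof.
move=> oU llin lc.
pose lL : {linear W -> W'} := HB.pack l (GRing.isLinear.Build _ _ _ _ l llin).
have ld x : differentiable l x by exact: (@linear_differentiable _ _ _ lL).
elim: k f => [|k IH] f.
  by move=> fc x Ux; apply: continuous_comp; [exact: fc|exact: lc].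
case=> df fC; split=> [x Ux|v]; first exact: differentiable_comp (df x Ux) _.
apply: (@Ck_ext k _ _ U (l \o (fun x => 'd f x v))) (IH _ (fC v)) => //.
move=> x Ux; rewrite (diff_comp (df x Ux) (ld _))/=.
by rewrite (@diff_lin _ _ _ lL).
Qed.

Lemma Ck_mul k (E : normedModType R) (U : set E) (f g : E -> R^o) :
  open U -> Ck_on k U f -> Ck_on k U g -> Ck_on k U (fun x => f x * g x : R^o).
Proof.
move=> oU; elim: k f g => [|k IH] f g Cf Cg.
  by move=> x Ux; apply: continuousM; [exact: Cf|exact: Cg].
have [df fC] := Cf; have [dg gC] := Cg.
split=> [x Ux|v].
  by apply: (@differentiableM _ _ f g); [exact: df|exact: dg].
have := Ck_add oU (IH _ _ (Ck_mono Cf) (gC v)) (IH _ _ (Ck_mono Cg) (fC v)).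
apply: Ck_ext => // x Ux; have := @diffM _ _ f g x (df x Ux) (dg x Ux).
by move=> /(congr1 (@^~ v)).
Qed.

Lemma differentiable_rsqrt (x : R) : 0 < x ->
  differentiable (fun t : R^o => (Num.sqrt t)^-1 : R^o) x /\
  forall v, 'd (fun t : R^o => (Num.sqrt t)^-1 : R^o) x v =
     - 2^-1 * (Num.sqrt x)^-1 * (Num.sqrt x)^-1 * (Num.sqrt x)^-1 * v.
Proof.
move=> x0; have s0 : Num.sqrt x != 0 by rewrite gt_eqF// sqrtr_gt0.
have ds := is_derive1_sqrt x0.
have df : differentiable (Num.sqrt : R -> R) x.
  by apply/derivable1_diffP; exact: ex_derive.
split; first exact: (@differentiableV _ _ (Num.sqrt : R -> R)).
move=> v; rewrite (@diffV _ _ (Num.sqrt : R -> R))//=.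
rewrite (deriv1E (ex_derive (is_derive := ds))) derive1E derive_sqrt// /GRing.scale/=.
by field.
Qed.

(** The power -1/2 serves both the normalisation in the Gram-Schmidt process and,
    when squared, the inversion of nonzero functions. The induction on [k] works
    because the derivative of t^(-1/2) is -1/2 times the cube of t^(-1/2). *)
Lemma Ck_rsqrt k (E : normedModType R) (U : set E) (f : E -> R^o) :
  open U -> (forall x, U x -> 0 < f x) -> Ck_on k U f ->
  Ck_on k U (fun x => (Num.sqrt (f x))^-1 : R^o).
Proof.
move=> oU f0; elim: k => [|k IH] Cf.
  move=> x Ux; have [d _] := differentiable_rsqrt (f0 x Ux).
  have := differentiable_continuous d.
  by move=> dc; apply: continuous_comp (Cf x Ux) dc.
have [df fC] := Cf; have {}IH := IH (Ck_mono Cf).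
split=> [x Ux|v].
  have [d _] := differentiable_rsqrt (f0 x Ux).
  exact: differentiable_comp (df x Ux) d.
have C := Ck_mul oU (Ck_mul oU (Ck_mul oU
  (Ck_mul oU (Ck_cst k U (- 2^-1 : R^o)) IH) IH) IH) (fC v).
apply: Ck_ext C => // x Ux.
have [d dE] := differentiable_rsqrt (f0 x Ux).
by rewrite [in RHS](diff_comp (df x Ux) d)/= dE.
Qed.

Lemma Ck_sum k n (E W : normedModType R) (U : set E) (f : 'I_n -> E -> W) :
  open U -> (forall i, Ck_on k U (f i)) ->
  Ck_on k U (fun x => \sum_(i < n) f i x).
Proof.
move=> oU; elim: n f => [|n IH] f fC.
  by apply: (Ck_ext oU _ (Ck_cst k U 0)) => x _; rewrite big_ord0.
have C := Ck_add oU (IH (fun i => f (widen_ord (leqnSn n) i)) (fun i => fC _))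
  (fC ord_max).
by apply: (Ck_ext oU _ C) => x _; rewrite big_ord_recr.
Qed.

Lemma Ck_coord k n (E : normedModType R) (U : set E) (f : E -> 'rV[R]_n) i :
  open U -> Ck_on k U f -> Ck_on k U (fun x => f x 0 i : R^o).
Proof.
move=> oU; apply: (@Ck_lin k E 'rV[R]_n R^o U f (fun u => u 0 i)) => //.
  by move=> a u v; rewrite !mxE.
exact: coord_continuous.
Qed.

Lemma Ck_rV k n (E : normedModType R) (U : set E) (f : E -> 'rV[R]_n) :
  open U -> (forall i, Ck_on k U (fun x => f x 0 i : R^o)) -> Ck_on k U f.
Proof.
move=> oU fC.
have := @Ck_sum k n E 'rV[R]_n U (fun i x => f x 0 i *: delta_mx 0 i) oU.
move=> C; apply: (Ck_ext oU _ (C _)) => [x _|i]; first by rewrite -row_sum_delta.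
apply: (@Ck_lin k E R^o 'rV[R]_n U (fun x => f x 0 i) ( *:%R^~ (delta_mx 0 i))) => //.
  by move=> a u v; rewrite scalerDl scalerA.
exact: scalel_continuous.
Qed.

(** By the chain rule, the derivative of the composite along [v] is the sum over
    the coordinates i of ('d g v)_i * ('d f e_i \o g), and the induction hypothesis
    applies to the second factor. *)
Lemma Ck_comp k n (E : normedModType R) (U : set E) (U2 : set 'rV[R]_n)
    (g : E -> 'rV[R]_n) (f : 'rV[R]_n -> R^o) :
  open U -> (forall x, U x -> U2 (g x)) ->
  Ck_on k U g -> Ck_on k U2 f -> Ck_on k U (f \o g).
Proof.
move=> oU UU; elim: k f => [|k IH] f gC fC.
  by move=> x Ux; apply: continuous_comp; [exact: gC|exact/fC/UU].
have [dg gC'] := gC; have [df fC'] := fC.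
split=> [x Ux|v]; first exact: differentiable_comp (dg x Ux) (df _ (UU _ Ux)).
have := @Ck_sum k n E R^o U (fun i x => 'd g x v 0 i * 'd f (g x) (delta_mx 0 i)) oU.
move=> C; apply: (Ck_ext oU _ (C _)) => [x Ux|i].
  rewrite (diff_comp (dg x Ux) (df _ (UU _ Ux)))/=.
  rewrite [X in _ = 'd f _ X]row_sum_delta linear_sum.
  by apply: eq_bigr => i _; rewrite linearZ.
apply: Ck_mul => //; first exact: (Ck_coord i oU (gC' v)).
exact: (IH _ (Ck_mono gC) (fC' (delta_mx 0 i))).
Qed.

Lemma Ck_compV k n p (E : normedModType R) (U : set E) (U2 : set 'rV[R]_n)
    (g : E -> 'rV[R]_n) (f : 'rV[R]_n -> 'rV[R]_p) :
  open U -> open U2 -> (forall x, U x -> U2 (g x)) ->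
  Ck_on k U g -> Ck_on k U2 f -> Ck_on k U (f \o g).
Proof.
move=> oU oU2 UU gC fC; apply: Ck_rV => // i.
exact: (Ck_comp (f := fun u => f u 0 i) oU UU gC (Ck_coord _ _ _)).
Qed.

End Calculus.

(** * Smooth functions on a manifold *)

Section SmoothFunctions.
Variables (R : realType) (m : nat) (M : manifold R m).
Implicit Types U : set M.

(** Every smoothness condition on an open set of the manifold is thus imposed on
    open sets of the model space, where it is local. *)
Lemma chart_image_open (i : chart M) U : open U -> open (cmap i @` (cdom i `&` U)).
Proof.
move=> oU; rewrite openE => _ [x [xi Ux] <-].
have Uinv : \forall y \near cmap i x, U (cinv i y).
  have := cinv_continuous xi.
  rewrite /prop_for /continuous_at cmapK//; apply.
  exact: open_nbhs_nbhs.
have img : \forall y \near cmap i x, (cmap i @` cdom i) y.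
  by apply: open_nbhs_nbhs; split; [exact: cimg_open|exists x].
rewrite /interior; apply: filterS2 Uinv img => y Uy [z zi zy].
by exists z => //; split=> //; rewrite -(cmapK zi) zy.
Qed.

Lemma msmooth_sub (W : normedModType R) U U' (f : M -> W) :
  U' `<=` U -> msmooth U f -> msmooth U' f.
Proof.
move=> UU fs i k; apply: Ck_sub (fs i k).
by apply: image_subset; exact: setIS.
Qed.

Lemma msmooth_local (W : normedModType R) U (f : M -> W) :
  (forall x, U x -> exists2 U', U' x & msmooth U' f) -> msmooth U f.
Proof.
move=> H i k; apply: Ck_local => _ [x [xi Ux] <-].
have [U' U'x fs] := H x Ux; exists (cmap i @` (cdom i `&` U')); last exact: fs.
by exists x.
Qed.

Lemma msmooth_ext (W : normedModType R) U (f g : M -> W) :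
  open U -> (forall x, U x -> f x = g x) -> msmooth U f -> msmooth U g.
Proof.
move=> oU fg fs i k; apply: Ck_ext (fs i k); first exact: chart_image_open.
by move=> _ [x [xi Ux] <-] /=; rewrite cmapK// fg.
Qed.

Lemma msmooth_cst (W : normedModType R) U (w : W) : msmooth U (fun _ => w).
Proof. by move=> i k; exact: Ck_cst. Qed.

Lemma msmooth_add (W : normedModType R) U (f g : M -> W) : open U ->
  msmooth U f -> msmooth U g -> msmooth U (fun x => f x + g x).
Proof.
by move=> oU fs gs i k; apply: Ck_add (fs i k) (gs i k); exact: chart_image_open.
Qed.

Lemma msmooth_mul U (f g : M -> R^o) : open U ->
  msmooth U f -> msmooth U g -> msmooth U (fun x => f x * g x : R^o).
Proof.
by move=> oU fs gs i k; apply: Ck_mul (fs i k) (gs i k); exact: chart_image_open.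
Qed.

Lemma msmooth_rsqrt U (f : M -> R^o) : open U -> (forall x, U x -> 0 < f x) ->
  msmooth U f -> msmooth U (fun x => (Num.sqrt (f x))^-1 : R^o).
Proof.
move=> oU f0 fs i k; apply: Ck_rsqrt (fs i k); first exact: chart_image_open.
by move=> _ [x [xi Ux] <-]; rewrite /= cmapK// f0.
Qed.

Lemma msmooth_rV n U (f : M -> 'rV[R]_n) : open U ->
  msmooth U f <-> forall i, msmooth U (fun x => f x 0 i : R^o).
Proof.
move=> oU; split=> [fs j i k|fs i k].
  exact: (@Ck_coord R k n _ _ (f \o cinv i) j (chart_image_open oU) (fs i k)).
by apply: Ck_rV => [|j]; [exact: chart_image_open|exact: (fs j i k)].
Qed.

Lemma msmooth_continuous (W : normedModType R) U (f : M -> W) x : open U ->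
  U x -> msmooth U f -> {for x, continuous f}.
Proof.
move=> oU Ux fs; have [i xi] := cdom_cover x.
have fc : {for cmap i x, continuous (f \o cinv i)}.
  by apply: (fs i 0%N); exists x.
have c : {for x, continuous ((f \o cinv i) \o cmap i)}.
  exact: continuous_comp (cmap_continuous xi) fc.
rewrite /prop_for /continuous_at -{2}(cmapK xi).
apply: cvg_trans c; apply: near_eq_cvg.
by apply: filterS (open_nbhs_nbhs (conj (@cdom_open _ _ M i) xi)) => y /= /cmapK->.
Qed.

Lemma msmooth_pos_open U (f : M -> R^o) : open U -> msmooth U f ->
  open [set x | U x /\ 0 < f x].
Proof.
move=> oU fs; rewrite openE => x [Ux fx]; rewrite /interior.
have := msmooth_continuous oU Ux fs.
move=> /(_ _ (open_nbhs_nbhs (conj (@open_gt R 0) fx))) /= N.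
exact: filterI (open_nbhs_nbhs (conj oU Ux)) N.
Qed.

Lemma csmooth_sub U U' (f : M -> R[i]) : U' `<=` U -> csmooth U f -> csmooth U' f.
Proof. by move=> UU [fr fi]; split; exact: msmooth_sub UU _. Qed.

Lemma csmooth_local U (f : M -> R[i]) :
  (forall x, U x -> exists2 U', U' x & csmooth U' f) -> csmooth U f.
Proof.
move=> H; split; apply: msmooth_local => x /H[U' U'x []]; by exists U'.
Qed.

Lemma csmooth_ext U (f g : M -> R[i]) :
  open U -> (forall x, U x -> f x = g x) -> csmooth U f -> csmooth U g.
Proof.
move=> oU fg [fr fi]; split.
- by apply: msmooth_ext fr => // x Ux; rewrite fg.
- by apply: msmooth_ext fi => // x Ux; rewrite fg.
Qed.

Lemma csmooth_cst U c : csmooth U (fun _ => c).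
Proof. by split; exact: msmooth_cst. Qed.

Lemma csmooth_add U (f g : M -> R[i]) : open U ->
  csmooth U f -> csmooth U g -> csmooth U (fun x => f x + g x).
Proof.
move=> oU [fr fi] [gr gi]; split.
- by apply: msmooth_ext (msmooth_add oU fr gr) => // x _; case: (f x); case: (g x).
- by apply: msmooth_ext (msmooth_add oU fi gi) => // x _; case: (f x); case: (g x).
Qed.

Lemma csmooth_mul U (f g : M -> R[i]) : open U ->
  csmooth U f -> csmooth U g -> csmooth U (fun x => f x * g x).
Proof.
move=> oU [fr fi] [gr gi]; split.
- have ii := msmooth_mul oU (msmooth_cst U (-1 : R^o)) (msmooth_mul oU fi gi).
  apply: msmooth_ext (msmooth_add oU (msmooth_mul oU fr gr) ii) => // x _.
  by case: (f x) => a b; case: (g x) => c d; rewrite /= mulN1r.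
- apply: msmooth_ext (msmooth_add oU (msmooth_mul oU fr gi) (msmooth_mul oU fi gr)) => // x _.
  by case: (f x) => a b; case: (g x) => c d.
Qed.

Lemma csmooth_sum (I : finType) U (f : I -> M -> R[i]) : open U ->
  (forall i, csmooth U (f i)) -> csmooth U (fun x => \sum_i f i x).
Proof.
move=> oU fs; elim: (index_enum I) => [|i r IH].
  by apply: (csmooth_ext oU _ (csmooth_cst U 0)) => x _; rewrite big_nil.
by apply: (csmooth_ext oU _ (csmooth_add oU (fs i) IH)) => x _; rewrite big_cons.
Qed.

Lemma csmooth_prod (I : finType) U (f : I -> M -> R[i]) : open U ->
  (forall i, csmooth U (f i)) -> csmooth U (fun x => \prod_i f i x).
Proof.
move=> oU fs; elim: (index_enum I) => [|i r IH].
  by apply: (csmooth_ext oU _ (csmooth_cst U 1)) => x _; rewrite big_nil.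
by apply: (csmooth_ext oU _ (csmooth_mul oU (fs i) IH)) => x _; rewrite big_cons.
Qed.

(** This is |f|^2, written as a polynomial in the real and imaginary parts of [f]
    to make its smoothness evident. *)
Definition complex_sqnorm (f : M -> R[i]) (x : M) : R^o :=
  complex.Re (f x) * complex.Re (f x) + complex.Im (f x) * complex.Im (f x).

Lemma complex_sqnorm_gt0 f x : (0 < complex_sqnorm f x) = (f x != 0).
Proof.
rewrite /complex_sqnorm; case: (f x) => a b /=; rewrite eq_complex /= -!expr2.
by rewrite lt0r addr_ge0 ?sqr_ge0// andbT paddr_eq0 ?sqr_ge0// !sqrf_eq0.
Qed.

Lemma complex_sqnorm_smooth U f : open U -> csmooth U f -> msmooth U (complex_sqnorm f).
Proof.
by move=> oU [fr fi]; exact: msmooth_add oU (msmooth_mul oU fr fr) (msmooth_mul oU fi fi).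
Qed.

Lemma csmooth_neq0_open U f : open U -> csmooth U f ->
  open [set x | U x /\ f x != 0].
Proof.
move=> oU fs; have := msmooth_pos_open oU (complex_sqnorm_smooth oU fs).
by congr (open _); apply/seteqP; split=> x /=; rewrite complex_sqnorm_gt0.
Qed.

(** 1/f is the conjugate of f divided by |f|^2. *)
Lemma csmooth_inv U f : open U -> (forall x, U x -> f x != 0) ->
  csmooth U f -> csmooth U (fun x => (f x)^-1).
Proof.
move=> oU f0 fs; have [fr fi] := fs.
have q0 x : U x -> 0 < complex_sqnorm f x by rewrite complex_sqnorm_gt0; exact: f0.
have qs := msmooth_rsqrt oU q0 (complex_sqnorm_smooth oU fs).
have {}qs := msmooth_mul oU qs qs.
have inv2 x : U x -> (Num.sqrt (complex_sqnorm f x))^-1 *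
    (Num.sqrt (complex_sqnorm f x))^-1 = (complex_sqnorm f x)^-1.
  by move=> /q0 q; rewrite -invfM -expr2 sqr_sqrtr// ltW.
split.
- apply: msmooth_ext (msmooth_mul oU fr qs) => // x Ux; rewrite inv2// /complex_sqnorm.
  by case: (f x) => a b /=; rewrite !expr2.
- have Nfi := msmooth_mul oU (msmooth_cst U (-1 : R^o)) fi.
  apply: msmooth_ext (msmooth_mul oU Nfi qs) => // x Ux.
  by rewrite inv2// /complex_sqnorm; case: (f x) => a b /=; rewrite mulN1r !expr2 mulNr.
Qed.

End SmoothFunctions.

(** * Smooth families of linear maps *)

Section HomMatrices.
Variable K : fieldType.

Lemma v2r_lfun (F F' : vectType K) (f : 'Hom(F, F')) (u : F) :
  v2r (f u) = v2r u *m f2mx f.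
Proof. by rewrite unlock /= r2vK. Qed.

Lemma lfun_r2v (F F' : vectType K) (f : 'Hom(F, F')) i j :
  v2r (f (r2v (delta_mx 0 i))) 0 j = f2mx f i j.
Proof. by rewrite v2r_lfun r2vK -rowE mxE. Qed.

Lemma f2mx_comp (F F' F'' : vectType K) (f : 'Hom(F', F'')) (g : 'Hom(F, F')) :
  f2mx (f \o g)%VF = f2mx g *m f2mx f.
Proof.
apply/row_matrixP => i; rewrite !rowE mulmxA -{1}(r2vK (delta_mx 0 i)).
by rewrite -v2r_lfun comp_lfunE !v2r_lfun r2vK.
Qed.

Lemma f2mx_id (F : vectType K) : f2mx (\1%VF : 'End(F)) = 1%:M.
Proof.
apply/row_matrixP => i; rewrite !rowE -{1}(r2vK (delta_mx 0 i)).
by rewrite -v2r_lfun id_lfunE r2vK mulmx1.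
Qed.

Lemma f2mx_unit (F : vectType K) (a : 'End(F)) :
  (f2mx a \in unitmx) = (lker a == 0%VS).
Proof.
apply/idP/idP => [au|/lker0_compVf ak].
  apply/lker0P => u v /(congr1 v2r); rewrite !v2r_lfun.
  by move=> /(can_inj (mulmxK au))/v2r_inj.
by have := congr1 f2mx ak; rewrite f2mx_comp f2mx_id => /mulmx1_unit[].
Qed.

(** Cramer's rule. *)
Lemma f2mx_inv (F : vectType K) (a : 'End(F)) : lker a == 0%VS ->
  f2mx a^-1%VF = (\det (f2mx a))^-1 *: \adj (f2mx a).
Proof.
rewrite -f2mx_unit => au.
by rewrite -[LHS]/(pinvmx (f2mx a)) pinvmxE// /invmx au.
Qed.

End HomMatrices.

Section SmoothHoms.
Variables (R : realType) (m : nat) (M : manifold R m).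
Implicit Types U : set M.

(** Every functional is a combination, with constant coefficients, of the coordinates
    given by [v2r]. *)
Lemma vsmoothP (F : vectType R[i]) U (f : M -> F) : open U ->
  vsmooth U f <-> forall j, csmooth U (fun x => v2r (f x) 0 j).
Proof.
move=> oU; split=> [fs j|fs l].
  pose l v := (v2r v 0 j : R[i]).
  have llin : linear l by move=> c u v; rewrite /l linearP !mxE.
  exact: (fs (HB.pack l (GRing.isLinear.Build _ _ _ _ l llin))).
apply: (csmooth_ext oU _ (csmooth_sum oU (fun j =>
   csmooth_mul oU (fs j) (csmooth_cst U (l (r2v (delta_mx 0 j))))))) => x _.
rewrite -[X in _ = l X]v2rK [X in _ = l (r2v X)]row_sum_delta !linear_sum.
by apply: eq_bigr => j _; rewrite !linearZ.
Qed.

Lemma hsmoothP (F F' : vectType R[i]) U (A : M -> 'Hom(F, F')) : open U ->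
  hsmooth U A <-> forall i j, csmooth U (fun x => f2mx (A x) i j).
Proof.
move=> oU; split=> [As i j|As s].
  have /vsmoothP := As (r2v (delta_mx 0 i)) => /(_ oU)/(_ j).
  by apply: csmooth_ext => // x _; exact: lfun_r2v.
apply/vsmoothP => // j; apply: (csmooth_ext oU _ (csmooth_sum oU (fun i =>
  csmooth_mul oU (csmooth_cst U (v2r s 0 i)) (As i j)))) => x _.
by rewrite v2r_lfun mxE.
Qed.

Section Closure.
Variables (F F' : vectType R[i]).
Implicit Types A B : M -> 'Hom(F, F').

Lemma hsmooth_sub U U' A : U' `<=` U -> hsmooth U A -> hsmooth U' A.
Proof. by move=> UU As s l; exact: csmooth_sub UU (As s l). Qed.

Lemma hsmooth_ext U A B : open U -> (forall x, U x -> A x = B x) ->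
  hsmooth U A -> hsmooth U B.
Proof. by move=> oU AB As s l; apply: csmooth_ext (As s l) => // x /AB->. Qed.

Lemma hsmooth_cst U (a : 'Hom(F, F')) : hsmooth U (fun _ => a).
Proof. by move=> s l; exact: csmooth_cst. Qed.

Lemma hsmooth_add U A B : open U -> hsmooth U A -> hsmooth U B ->
  hsmooth U (fun x => A x + B x).
Proof.
move=> oU As Bs s l; apply: (csmooth_ext oU _ (csmooth_add oU (As s l) (Bs s l))).
by move=> x _; rewrite add_lfunE linearD.
Qed.

Lemma hsmooth_scale U (c : R[i]) A : open U -> hsmooth U A ->
  hsmooth U (fun x => c *: A x).
Proof.
move=> oU As s l; apply: (csmooth_ext oU _ (csmooth_mul oU (csmooth_cst U c) (As s l))).
by move=> x _; rewrite scale_lfunE linearZ.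
Qed.

End Closure.

Lemma hsmooth_comp (F F' F'' : vectType R[i]) U (A : M -> 'Hom(F', F''))
    (B : M -> 'Hom(F, F')) : open U -> hsmooth U A -> hsmooth U B ->
  hsmooth U (fun x => (A x \o B x)%VF).
Proof.
move=> oU /(hsmoothP _ oU) As /(hsmoothP _ oU) Bs; apply/hsmoothP => // i j.
apply: (csmooth_ext oU _ (csmooth_sum oU (fun k => csmooth_mul oU (Bs i k) (As k j)))).
by move=> x _; rewrite f2mx_comp mxE.
Qed.

Lemma csmooth_det n U (A : M -> 'M[R[i]]_n) : open U ->
  (forall i j, csmooth U (fun x => A x i j)) -> csmooth U (fun x => \det (A x)).
Proof.
move=> oU As; apply: csmooth_sum => // s.
by apply: csmooth_mul (csmooth_cst _ _) (csmooth_prod oU (fun i => As i _)).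
Qed.

Lemma endsmooth_inv (F : vectType R[i]) U (A : M -> 'End(F)) : open U ->
  (forall x, U x -> lker (A x) == 0%VS) -> hsmooth U A ->
  hsmooth U (fun x => (A x)^-1%VF).
Proof.
move=> oU A0 As; have /(hsmoothP _ oU) As' := As; apply/hsmoothP => // i j.
have dets : csmooth U (fun x => (\det (f2mx (A x)))^-1).
  apply: csmooth_inv (csmooth_det oU As') => // x /A0.
  by rewrite -f2mx_unit unitmxE unitfE.
have cofs : csmooth U (fun x => cofactor (f2mx (A x)) j i).
  apply: csmooth_mul (csmooth_cst _ _) _ => //; apply: csmooth_det => // k l.
  by apply: (csmooth_ext oU _ (As' (lift j k) (lift i l))) => x _; rewrite !mxE.
apply: csmooth_ext (csmooth_mul oU dets cofs) => // x Ux.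
by rewrite f2mx_inv ?A0// !mxE.
Qed.

(** Composition with the inverse of [A] at a fixed point reduces the assertion to
    endomorphisms, where Cramer's rule applies. *)
Lemma hsmooth_inv (F F' : vectType R[i]) U (A : M -> 'Hom(F, F')) : open U ->
  (forall x, U x -> bijective (A x)) -> hsmooth U A ->
  hsmooth U (fun x => (A x)^-1%VF).
Proof.
move=> oU Ab As; have [[x0 Ux0]|/forallNP U0] := pselect (exists x, U x); last first.
  by move=> s l; apply: csmooth_local => x /U0.
have [B AB BA] := Ab x0 Ux0; pose b := ((A x0)^-1)%VF.
have bE := inv_lfunP AB BA.
have C0 x : U x -> lker (b \o A x)%VF == 0%VS.
  move=> /Ab[Bx ABx BAx]; apply/lker0P => u v; rewrite !comp_lfunE !bE.
  by move=> /(can_inj BA)/(can_inj ABx).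
have := hsmooth_comp oU (endsmooth_inv oU C0 (hsmooth_comp oU (hsmooth_cst U b) As))
  (hsmooth_cst U b).
apply: hsmooth_ext => // x Ux; have [Bx ABx BAx] := Ab x Ux.
apply/lfunP => s; rewrite (inv_lfunP ABx BAx) comp_lfunE /= -{1}(BAx s).
by rewrite -[b (A x _)]comp_lfunE lker0_lfunK// C0.
Qed.

(** The determinant of [A x] relative to [A x0] is a continuous function of x which
    does not vanish at [x0]. *)
Lemma hsmooth_bij_open (F F' : vectType R[i]) U (A : M -> 'Hom(F, F')) x0 :
  open U -> U x0 -> bijective (A x0) -> hsmooth U A ->
  exists U', [/\ open U', U' x0, U' `<=` U & forall x, U' x -> bijective (A x)].
Proof.
move=> oU Ux0 [B AB BA] As; pose b := ((A x0)^-1)%VF.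
have bE := inv_lfunP AB BA; pose C x := (b \o A x)%VF.
have Cs : hsmooth U C by exact: hsmooth_comp oU (hsmooth_cst U b) As.
have ds := csmooth_det oU (proj1 (hsmoothP C oU) Cs).
have detE x : (\det (f2mx (C x)) != 0) = (lker (C x) == 0%VS).
  by rewrite -f2mx_unit unitmxE unitfE.
exists [set x | U x /\ \det (f2mx (C x)) != 0]; split.
- exact: csmooth_neq0_open.
- split=> //; rewrite detE; apply/lker0P => u v; rewrite !comp_lfunE !bE.
  by move=> /(can_inj BA)/(can_inj AB).
- by move=> x [].
- move=> x [_]; rewrite detE => C0; exists (((C x)^-1)%VF \o b) => u /=.
    by rewrite -[b (A x _)]comp_lfunE lker0_lfunK.
  apply: (can_inj BA); rewrite -!bE.
  by rewrite -[b (A x _)]comp_lfunE lker0_lfunVK.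
Qed.

End SmoothHoms.

Lemma hsmooth_local (R : realType) (m : nat) (M : manifold R m)
    (F F' : vectType R[i]) (U : set M) (A : M -> 'Hom(F, F')) :
  (forall x, U x -> exists2 U', U' x & hsmooth U' A) -> hsmooth U A.
Proof.
move=> H s l; apply: csmooth_local => x /H[U' U'x As].
by exists U' => //; exact: As.
Qed.

(** * Vector fields and orthonormal frames *)

Section VectorFields.
Variables (R : realType) (m : nat) (M : manifold R m).
Implicit Types U : set M.

Lemma chart_diff (i j : chart M) x : cdom i x -> cdom j x ->
  differentiable (cmap j \o cinv i) (cmap i x).
Proof. by move=> xi xj; have [+ _] := cmap_smooth i j 1%N; apply; exists x. Qed.

Lemma chart_chain (i j k : chart M) x u : cdom i x -> cdom j x -> cdom k x ->
  'd (cmap k \o cinv i) (cmap i x) u =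
  'd (cmap k \o cinv j) (cmap j x) ('d (cmap j \o cinv i) (cmap i x) u).
Proof.
move=> xi xj xk; have dij := chart_diff xi xj.
have E : (cmap j \o cinv i) (cmap i x) = cmap j x by rewrite /= cmapK.
have djk : differentiable (cmap k \o cinv j) ((cmap j \o cinv i) (cmap i x)).
  by rewrite E; exact: chart_diff.
have := congr1 (@^~ u) (diff_comp dij djk); rewrite E.
move=> T; apply: etrans T.
have [|_ H] := @near_eq_diff R _ _ ((cmap k \o cinv j) \o (cmap j \o cinv i))
   (cmap k \o cinv i) (cmap i x) _ (differentiable_comp dij djk); last first.
  by move/(congr1 (@^~ u)): H.
have oN := chart_image_open (i := i) (@cdom_open _ _ M j).
have xN : (cmap i @` (cdom i `&` cdom j)) (cmap i x) by exists x.
have N := open_nbhs_nbhs (conj oN xN).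
apply: filterS N => _ [y [yi yj] <-] /=.
by rewrite !cmapK.
Qed.

(** A vector field has a value at every point of the manifold, hence the zero outside
    the chart [i]; the field with constant components [u] is smooth on the chart. *)
Definition cst_family (i : chart M) (u : 'rV[R]_m) (x : M) : chart M -> 'rV[R]_m :=
  fun j => if `[< cdom i x /\ cdom j x >] then 'd (cmap j \o cinv i) (cmap i x) u
           else 0.

Lemma cst_family_tangent i u x : cst_family i u x \in tangent_pred x.
Proof.
apply/asboolP; split=> [j xj|j k xj xk]; rewrite /cst_family.
  by case: asboolP => // -[].
case: asboolP => [[xi _]|nij]; last first.
  by case: asboolP => [[xi _]|_]; [case: nij|rewrite linear0].
by case: asboolP => [_|[]//]; exact: chart_chain.
Qed.

Definition cst_field i u : vfield M := fun x => Tangent (cst_family_tangent i u x).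

Lemma cst_field_smooth i u : smooth_vfield (cdom i) (cst_field i u).
Proof.
move=> j l k; have oij := openI (@cdom_open _ _ M i) (@cdom_open _ _ M j).
have C := @Ck_compV R k m m _ (cmap l @` (cdom l `&` (cdom i `&` cdom j)))
  (cmap i @` (cdom i `&` cdom j)) (cmap i \o cinv l)
  (fun y => 'd (cmap j \o cinv i) y u).
apply: Ck_ext (C _ _ _ _ _) => //=.
- exact: chart_image_open.
- move=> _ [x [xl [xi xj]] <-] /=; rewrite cmapK// /cst_family.
  by case: asboolP => // -[].
- exact: chart_image_open.
- exact/chart_image_open/cdom_open.
- by move=> _ [x [xl [xi xj]] <-]; exists x => //=; rewrite cmapK.
- apply: Ck_sub (cmap_smooth l i k).
  by apply: image_subset => x [xl []].
- by have [_] := cmap_smooth i j k.+1; apply.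
Qed.

Lemma cst_fieldE i x (w : tangent x) : cdom i x -> cst_field i (tvec w i) x = w.
Proof.
move=> xi; apply/val_inj/funext => j /=; rewrite /cst_family.
have /asboolP[w0 wD] := tvec_subproof w.
case: asboolP => [[_ xj]|nij]; first by rewrite (wD i j).
by rewrite w0// => xj; apply: nij.
Qed.

Lemma vfield_smooth_sub U U' (X : vfield M) : U' `<=` U ->
  smooth_vfield U X -> smooth_vfield U' X.
Proof. by move=> UU Xs i; apply: msmooth_sub (Xs i); exact: setSI. Qed.

Lemma vfield_smooth_local U (X : vfield M) :
  (forall x, U x -> exists2 U', U' x & smooth_vfield U' X) -> smooth_vfield U X.
Proof.
move=> H i; apply: msmooth_local => x [Ux xi]; have [U' U'x Xs] := H x Ux.
by exists (U' `&` cdom i) => //; exact: Xs.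
Qed.

Lemma vfield_smooth_ext U (X Y : vfield M) : open U ->
  (forall x, U x -> X x = Y x) -> smooth_vfield U X -> smooth_vfield U Y.
Proof.
move=> oU XY Xs i; apply: msmooth_ext (Xs i) => [|x [Ux _]]; last by rewrite XY.
exact/openI/cdom_open.
Qed.

Lemma vfield_smooth_add U (X Y : vfield M) : open U ->
  smooth_vfield U X -> smooth_vfield U Y ->
  smooth_vfield U (fun x => X x + Y x).
Proof.
move=> oU Xs Ys i; have oUi := openI oU (@cdom_open _ _ M i).
exact: msmooth_add oUi (Xs i) (Ys i).
Qed.

Lemma vfield_smooth_scale U (f : M -> R^o) (X : vfield M) : open U ->
  msmooth U f -> smooth_vfield U X -> smooth_vfield U (fun x => (f x : R) *: X x).
Proof.
move=> oU fs Xs i; have oUi := openI oU (@cdom_open _ _ M i).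
apply/msmooth_rV => // j.
have Xij := proj1 (msmooth_rV _ oUi) (Xs i) j.
apply: msmooth_ext (msmooth_mul oUi (msmooth_sub (@subIsetl _ _ _) fs) Xij) => //.
by move=> x _; rewrite -[tvec (_ *: _) i]/(f x *: tvec (X x) i) mxE.
Qed.

Lemma vfield_smooth0 U : smooth_vfield U (fun x => 0).
Proof. by move=> i; exact: msmooth_cst. Qed.

Lemma vfield_smooth_sum n U (X : 'I_n -> vfield M) : open U ->
  (forall i, smooth_vfield U (X i)) -> smooth_vfield U (fun x => \sum_i X i x).
Proof.
move=> oU Xs; elim: (index_enum 'I_n) => [|i r IH].
  by apply: (vfield_smooth_ext oU _ (@vfield_smooth0 U)) => x _; rewrite big_nil.
by apply: (vfield_smooth_ext oU _ (vfield_smooth_add oU (Xs i) IH)) => x _; rewrite big_cons.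
Qed.

Section Frames.
Variable g : metric M.

Lemma gform_linear_l x w : linear ((g x)^~ w : tangent x -> R^o).
Proof. by move=> a u v; have [_ gl] := g_bilinear g x; exact: gl. Qed.

Lemma gform_linear_r x w : linear (g x w : tangent x -> R^o).
Proof. by move=> a u v; have [gr _] := g_bilinear g x; exact: gr. Qed.

Lemma gformZl x a (u w : tangent x) : g x (a *: u) w = a * g x u w.
Proof. exact: (linfZ (gform_linear_l w)). Qed.

Lemma gformZr x a (u w : tangent x) : g x w (a *: u) = a * g x w u.
Proof. exact: (linfZ (gform_linear_r w)). Qed.

Lemma gformDr x (u v w : tangent x) : g x w (u + v) = g x w u + g x w v.
Proof. exact: (linfD (gform_linear_r w)). Qed.

Variables (n : nat) (x0 : M) (e : nat -> tangent x0) (eps : nat -> R).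
Hypothesis eps2 : forall i, (i < n)%N -> eps i * eps i = 1.
Hypothesis e_orth : forall i j, (i < n)%N -> (j < n)%N ->
  g x0 (e i) (e j) = if i == j then eps i else 0.

(** The Gram-Schmidt process. The vector [X k] is normalised on the open set where
    its square has the right sign, and its multiples are subtracted from the later
    ones. At [x0], where the vectors are orthonormal already, nothing changes. *)
Lemma partial_orthonormal_frame k : (k <= n)%N ->
  exists U (X : nat -> vfield M),
  [/\ open U, U x0, forall i, smooth_vfield U (X i), forall i, (i < n)%N -> X i x0 = e i &
      forall x, U x -> forall i j, (i < k)%N -> (j < n)%N ->
        g x (X i x) (X j x) = if i == j then eps i else 0].
Proof.
elim: k => [_|k IH kn].
  have [c x0c] := cdom_cover x0.
  exists (cdom c), (fun i => cst_field c (tvec (e i) c)); split=> //.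
  - exact: cdom_open.
  - by move=> i; exact: cst_field_smooth.
  - by move=> i _; exact: cst_fieldE.
have [U [X [oU Ux0 Xs Xe XO]]] := IH (ltnW kn).
pose f x : R := eps k * g x (X k x) (X k x).
pose r x : R := (Num.sqrt (f x))^-1.
pose U' := [set x | U x /\ 0 < f x].
have fs : msmooth U (f : M -> R^o).
  exact: msmooth_mul oU (msmooth_cst _ _) (g_smooth g oU _ _).
have oU' : open U' by exact: msmooth_pos_open.
have U'U : U' `<=` U by move=> x [].
have rs : msmooth U' (r : M -> R^o).
  by apply: msmooth_rsqrt => //; [move=> x []|exact: msmooth_sub fs].
have Xs' i : smooth_vfield U' (X i) by exact: vfield_smooth_sub (Xs i).
pose b i x : R := - (eps k * (r x * (r x * g x (X i x) (X k x)))).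
have bs i : msmooth U' (b i : M -> R^o).
  have := msmooth_mul oU' (msmooth_cst U' (- eps k : R^o))
    (msmooth_mul oU' rs (msmooth_mul oU' rs (g_smooth g oU' (Xs' i) (Xs' k)))).
  by apply: msmooth_ext => // x _; rewrite mulNr.
pose Y i : vfield M := fun x =>
  if (i < k)%N then X i x else if i == k then r x *: X k x
  else b i x *: X k x + X i x.
have f1 : f x0 = 1 by rewrite /f Xe// e_orth// eqxx eps2.
have r1 : r x0 = 1 by rewrite /r f1 sqrtr1 invr1.
have rr x : U' x -> r x * r x * g x (X k x) (X k x) = eps k.
  move=> [Ux fx]; have -> : r x * r x = (f x)^-1.
    by rewrite -invfM -expr2 sqr_sqrtr// ltW.
  have -> : g x (X k x) (X k x) = eps k * f x by rewrite mulrA eps2// mul1r.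
  by rewrite mulrCA mulVf ?mulr1// gt_eqF.
exists U', Y; split=> //.
- by split=> //; rewrite f1.
- move=> i; rewrite /Y; case: (i < k)%N => //; case: (i == k).
    exact: vfield_smooth_scale.
  by apply: vfield_smooth_add => //; exact: vfield_smooth_scale.
- move=> i ni; rewrite /Y; case: ifP => ik; first exact: Xe.
  case: eqP => [->|/eqP ik']; first by rewrite r1 scale1r Xe.
  by rewrite /b !Xe// e_orth// (negPf ik') !mulr0 oppr0 scale0r add0r.
- move=> x U'x i j; have Ux := U'U x U'x; rewrite ltnS leq_eqVlt => /predU1P[->|ik] jn.
    rewrite {1}/Y ltnn eqxx /Y gformZl; case: ifP => jk.
      by rewrite g_sym XO// (eq_sym k) !(ltn_eqF jk) mulr0.
    case: eqP => [->|/eqP jk']; first by rewrite eqxx gformZr mulrA rr.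
    rewrite gformDr gformZr eq_sym (negPf jk') /b (g_sym _ (X k x) (X j x)).
    have := rr x U'x; set p := g x (X k x) (X k x); set q := g x (X j x) (X k x) => rrx.
    rewrite (_ : _ + q = q * (1 - eps k * (r x * r x * p))); last by ring.
    by rewrite rrx eps2// subrr !mulr0.
  rewrite {1}/Y ik; have ik' := ltn_eqF ik.
  rewrite /Y; case: ifP => _; first exact: XO.
  case: eqP => [->|/eqP jk]; first by rewrite gformZr XO// ik' mulr0.
  by rewrite gformDr gformZr !XO// ik' mulr0 add0r.
Qed.

Lemma orthonormal_frame :
  exists U (X : nat -> vfield M),
  [/\ open U, U x0, forall i, smooth_vfield U (X i), forall i, (i < n)%N -> X i x0 = e i &
      forall x, U x -> forall i j, (i < n)%N -> (j < n)%N ->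
        g x (X i x) (X j x) = if i == j then eps i else 0].
Proof. exact: partial_orthonormal_frame. Qed.

End Frames.
End VectorFields.

(** * Quadratic spaces and their Clifford operators *)

Section OrthonormalBasis.
Variables (R : realType) (V : vectType R) (h : V -> R).
Hypothesis h_quad : nondeg_quadform h.
Local Notation b := (polar h).

Lemma polarC u v : b u v = b v u.
Proof. by rewrite /polar [u + v]addrC addrAC. Qed.

Lemma polar_linear u : linear (b u : V -> R^o).
Proof. by have [_ [bl _] _] := h_quad; exact: bl. Qed.

Lemma polarZl a u v : b (a *: u) v = a * b u v.
Proof. by rewrite polarC (linfZ (@polar_linear v)) polarC. Qed.

Lemma polarZr a u v : b u (a *: v) = a * b u v.
Proof. exact: (linfZ (@polar_linear u)). Qed.

Lemma quadZ a v : h (a *: v) = a ^+ 2 * h v.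
Proof. by have [hZ _ _] := h_quad. Qed.

Lemma polar_diag v : b v v = 2 * h v.
Proof.
rewrite /polar -[v + v]/(v *+ 2) -scaler_nat quadZ.
by rewrite (_ : 2%:R ^+ 2 = 4 :> R); [ring|rewrite expr2; ring].
Qed.

(** The sequences [e] and [eps] are indexed by [nat], only their first [k] terms
    being meaningful, which makes the extension of an orthonormal family easy to
    write. The polar form satisfies b(v, v) = 2 h(v), so that h(e_i) = eps_i. *)
Definition orthonormal (k : nat) (e : nat -> V) (eps : nat -> R) : Prop :=
  (forall i, (i < k)%N -> eps i * eps i = 1) /\
  (forall i j, (i < k)%N -> (j < k)%N ->
     b (e i) (e j) = if i == j then 2 * eps i else 0).

Definition orthoproj k (e : nat -> V) (eps : nat -> R) (v : V) : V :=
  v - \sum_(i < k) (eps i / 2 * b v (e i)) *: e i.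

Lemma orthoproj_orth k e eps v j : orthonormal k e eps -> (j < k)%N ->
  b (orthoproj k e eps v) (e j) = 0.
Proof.
move=> [eps2 eO] jk; rewrite polarC (linfB (@polar_linear (e j))).
rewrite (linf_sum (@polar_linear (e j))) (bigD1 (Ordinal jk))//= big1 ?addr0.
  rewrite polarZr eO// eqxx (polarC (e j)); set x := b v _.
  rewrite (_ : x - _ = x * (1 - eps j * eps j)); last by field.
  by rewrite eps2// subrr mulr0.
move=> i ij; rewrite polarZr eO// ifN ?mulr0//.
by rewrite eq_sym; move: ij; rewrite -(inj_eq val_inj).
Qed.

(** Each v is then equal to the combination of the e_i that is subtracted from it. *)
Lemma orthoproj0_full k e eps :
  (forall v, orthoproj k e eps v = 0) -> (\dim {:V}%VS <= k)%N.
Proof.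
move=> p0; pose X := [tuple e i | i < k].
apply: leq_trans (_ : \dim <<X>>%VS <= k)%N; last first.
  by rewrite (leq_trans (dim_span _))// size_tuple.
apply: dimvS; apply/subvP => v _; have /eqP := p0 v; rewrite subr_eq0 => /eqP->.
apply: memv_suml => i _; apply/memvZ/memv_span.
by apply/tnthP; exists i; rewrite tnth_mktuple.
Qed.

(** If h vanished on the orthogonal complement of the family, then so would the polar
    form, and by non-degeneracy the complement would be zero. Hence an orthonormal
    family with fewer than dim V elements can be extended. *)
Lemma orthonormal_exists k : (k <= \dim {:V}%VS)%N ->
  exists e eps, orthonormal k e eps.
Proof.
elim: k => [_|k IH kV]; first by exists (fun=> 0), (fun=> 1); split.
have [e [eps eO]] := IH (ltnW kV); have [eps2 eO2] := eO.
have [w wO hw] : exists2 w, (forall i, (i < k)%N -> b w (e i) = 0) & h w != 0.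
  apply: contrapT => noW; suff : (\dim {:V}%VS <= k)%N by rewrite leqNgt kV.
  have hW w : (forall i, (i < k)%N -> b w (e i) = 0) -> h w = 0.
    by move=> wO; apply/eqP/negPn/negP => hw; apply: noW; exists w.
  apply: (@orthoproj0_full k e eps) => v; have [_ _ nondeg] := h_quad.
  apply: nondeg => u; set w := orthoproj _ _ _ v.
  have wO i : (i < k)%N -> b w (e i) = 0 by exact: orthoproj_orth.
  have uO i : (i < k)%N -> b (orthoproj k e eps u) (e i) = 0.
    exact: orthoproj_orth.
  have : b w (orthoproj k e eps u) = 0.
    rewrite /polar !hW ?subr0// => i ik.
    by rewrite polarC (linfD (@polar_linear _)) ![b (e i) _]polarC wO// uO// addr0.
  rewrite (linfB (@polar_linear w)) (linf_sum (@polar_linear w)) big1 ?subr0//.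
  by move=> i _; rewrite polarZr wO// mulr0.
pose c := (Num.sqrt `|h w|)^-1.
exists (fun i => if i == k then c *: w else e i).
exists (fun i => if i == k then Num.sg (h w) else eps i); split.
  move=> i; rewrite ltnS leq_eqVlt; case: eqP => [-> _|_ /= ik]; last exact: eps2.
  by rewrite -expr2 sqr_sg hw.
move=> i j; rewrite !ltnS (leq_eqVlt i) (leq_eqVlt j).
case: (eqVneq i k) => [->|ik] /=; case: (eqVneq j k) => [->|jk] /=.
- move=> _ _; rewrite polar_diag quadZ; congr (2 * _).
  by rewrite exprVn sqr_sqrtr// [X in _ * X = _]numEsg mulrCA mulVf ?mulr1// normr_eq0.
- by move=> _ jk'; rewrite polarZl wO// mulr0.
- by move=> ik' _; rewrite (negPf ik) polarZr polarC wO// mulr0.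
- exact: eO2.
Qed.

Lemma orthonormal_expand e eps v : orthonormal (\dim {:V}%VS) e eps ->
  v = \sum_(i < \dim {:V}%VS) (eps i / 2 * b v (e i)) *: e i.
Proof.
move=> eO; have [eps2 eO2] := eO; set k := \dim {:V}%VS in eO eO2 eps2 *.
pose X := [tuple e i | i < k].
have XE (i : 'I_k) : X`_i = e i by rewrite -tnth_nth tnth_mktuple.
have Xfree : free X.
  apply/freeP => c c0 i; have := congr1 (b (e i)) c0.
  rewrite (linf0 (@polar_linear _)) (linf_sum (@polar_linear _)) (bigD1 i)//= big1.
    rewrite XE addr0 polarZr eO2// eqxx => /eqP; rewrite !mulf_eq0 pnatr_eq0/=.
    case/orP => [/eqP//|/eqP ei].
    by have := eps2 i (ltn_ord i); rewrite ei mulr0 => /esym/eqP; rewrite oner_eq0.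
  move=> j ji; rewrite XE polarZr eO2// ifN ?mulr0// eq_sym.
  by move: ji; rewrite -(inj_eq val_inj).
have Xfull : <<X>>%VS = fullv.
  apply/eqP; rewrite eqEdim subvf /=.
  by move: Xfree; rewrite /free => /eqP->; rewrite size_tuple.
apply/eqP; rewrite -subr_eq0; apply/eqP; have [_ _ nondeg] := h_quad.
apply: nondeg => u; rewrite -/(orthoproj k e eps v).
have uX : u \in <<X>>%VS by rewrite Xfull memvf.
rewrite (coord_span uX) (linf_sum (@polar_linear _)) big1// => i _.
by rewrite polarZr XE orthoproj_orth// mulr0.
Qed.

End OrthonormalBasis.

Section CliffordModules.
Variables (K : fieldType) (n : nat) (eps : nat -> K).
Hypothesis eps2 : forall i, (i < n)%N -> eps i * eps i = 1.

(** A module over a Clifford algebra, given by the operators of the vectors of an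
    orthonormal basis; in this form S, Sigma_x and the typical fibre of Sigma can be
    treated in the same way. *)
Definition clifford_ops (E : lmodType K) (rho : nat -> E -> E) : Prop :=
  [/\ forall i, linear (rho i),
      forall i s, (i < n)%N -> rho i (rho i s) = eps i *: s &
      forall i j s, (i < n)%N -> (j < n)%N -> i != j ->
        rho i (rho j s) = - rho j (rho i s)].

(** The product of all generators. The partial product of the first k of them
    commutes with a generator up to the sign (-1)^k, or (-1)^(k-1) if the generator is
    one of its factors. *)
Lemma volume_operator (E : lmodType K) (rho : nat -> E -> E) :
  clifford_ops rho ->
  exists eta : E -> E,
    [/\ linear eta, exists eta', cancel eta' eta &
        forall i s, (i < n)%N -> eta (rho i s) = (-1) ^+ n.+1 *: rho i (eta s)].
Proof.
move=> [rl rr ra].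
suff H k : (k <= n)%N -> exists eta : E -> E,
    [/\ linear eta, exists eta', cancel eta' eta &
        forall i s, (i < n)%N ->
          eta (rho i s) = (-1) ^+ (k + (i < k)%N) *: rho i (eta s)].
  have [eta [el es eE]] := H n (leqnn n); exists eta; split=> // i s ik.
  by rewrite eE// ik addn1.
elim: k => [_|k IH kn].
  by exists id; split=> // [|i s _]; [exists id|rewrite expr0 scale1r].
have [eta [el [eta' es] eE]] := IH (ltnW kn).
exists (eta \o rho k); split.
- exact: linear_comp.
- exists (fun s => rho k (eps k *: eta' s)) => s /=.
  by rewrite rr// scalerA eps2// scale1r es.
- move=> i s ik /=; have [->|ik'] := eqVneq i k.
    by rewrite ltnSn eE// eE// ltnn addn0 addn1 !exprS !mulN1r opprK.
  rewrite ra// 1?eq_sym// (linfN el) eE// ltnS -scaleNr.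
  by rewrite addSn exprS mulN1r (ltn_neqAle i k) ik' /=.
Qed.

Section UniformSign.
Variables (E E' : lmodType K) (rho : nat -> E -> E) (tau : nat -> E' -> E').
Hypotheses (rhoC : clifford_ops rho) (tauC : clifford_ops tau).

(** B is A plus its image under the involution A |-> eps_k tau_k A rho_k, hence is
    invariant under it; as the involutions attached to different generators commute,
    the behaviour of A with respect to the other generators is inherited by B. *)
Lemma average_intertwines (A : E -> E') (c : K) k : (k < n)%N -> linear A ->
  (forall i s, (i < k)%N -> tau i (A s) = c *: A (rho i s)) ->
  let B s := A s + eps k *: tau k (A (rho k s)) in
  [/\ linear B, forall i s, (i < k)%N -> tau i (B s) = c *: B (rho i s) &
      forall s, tau k (B s) = B (rho k s)].
Proof.
have [rl rr ra] := rhoC; have [tl tt ta] := tauC.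
move=> kn Al Ac B; split=> [a s t|i s ik|s].
- rewrite /B rl !Al tl !scalerDr scalerA mulrC -scalerA.
  by rewrite !addrA; congr (_ + _); rewrite -!addrA; congr (_ + _); exact: addrC.
- have iN : (i < n)%N := ltn_trans ik kn.
  rewrite /B (linfD (tl i)) (linfZ (tl i)) Ac// ta// ?neq_ltn ?ik// Ac//.
  rewrite ra ?neq_ltn ?ik// (linfN Al) (scalerN c) (linfN (tl k)) opprK.
  by rewrite (linfZ (tl k)) scalerDr !scalerA mulrC.
- rewrite /B (linfD (tl k)) (linfZ (tl k)) tt// rr// scalerA eps2// !scale1r.
  by rewrite (linfZ Al) (linfZ (tl k)) scalerA eps2// scale1r addrC.
Qed.

(** The involutions A |-> eps_i tau_i A rho_i commute, so they have a common
    eigenvector, whose eigenvalues 1 and -1 are then made equal by composition with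
    generators. The common sign remains: for odd [n], the representations sigma and sigma o alpha are
    not equivalent, but intertwined by the identity with sign -1. *)
Lemma intertwiner_up_to_sign (A0 : E -> E') (s0 : E) :
  linear A0 -> A0 s0 != 0 ->
  exists (A : E -> E') (c : K), [/\ linear A, exists s, A s != 0,
    c = 1 \/ c = -1 & forall i s, (i < n)%N -> tau i (A s) = c *: A (rho i s)].
Proof.
move=> A0l A0n; have [rl rr ra] := rhoC; have [tl tt ta] := tauC.
suff H k : (k <= n)%N -> exists (A : E -> E') (c : K),
    [/\ linear A, exists s, A s != 0, c = 1 \/ c = -1 &
        forall i s, (i < k)%N -> tau i (A s) = c *: A (rho i s)].
  exact: H n (leqnn n).
elim: k => [_|k IH kn]; first by exists A0, 1; split=> //; [exists s0|left].
have [A [c [Al An c1 Ac]]] := IH (ltnW kn).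
(* B may have a sign d for the generator k that differs from the common sign c of the
   preceding ones; as rho k anticommutes with these, B \o rho k has the sign d for all *)
suff [B [d [Bl [s Bs] d1 Bc Bd]]] : exists (B : E -> E') (d : K),
    [/\ linear B, exists s, B s != 0, d = 1 \/ d = -1,
        forall i s, (i < k)%N -> tau i (B s) = c *: B (rho i s) &
        forall s, tau k (B s) = d *: B (rho k s)].
  have [cd|cd] := eqVneq c d.
    exists B, d; split=> // [|i t]; first by exists s.
    by rewrite ltnS leq_eqVlt => /predU1P[->//|/Bc->]; rewrite cd.
  have {cd} dc : d = - c.
    by case: c1 d1 cd => -> [] ->; rewrite ?eqxx ?opprK.
  exists (B \o rho k), d; split=> //.
  - exact: linear_comp.
  - exists (rho k s); rewrite /= rr// (linfZ Bl) scaler_eq0 negb_or Bs andbT.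
    by apply/eqP => e0; have := eps2 kn; rewrite e0 mulr0 => /esym/eqP; rewrite oner_eq0.
  - move=> i t; rewrite ltnS leq_eqVlt => /predU1P[->|ik] /=; first exact: Bd.
    rewrite Bc// ra// ?(ltn_trans ik)// ?neq_ltn ?ik//.
    by rewrite (linfN Bl) dc scalerN scaleNr.
have [Bl Bc Bk] := average_intertwines kn Al Ac; set B := (fun s => _) in Bl Bc Bk.
have [[s Bs]|/forallNP B0] := pselect (exists s, B s != 0).
  exists B, 1; split=> //; [by exists s|by left|by move=> t; rewrite Bk scale1r].
(* the average vanishes exactly if A is an eigenvector for -1 *)
exists A, (-1); split=> //; first by right.
move=> s; have /negP/negPn/eqP := B0 (rho k s).
rewrite /B rr// (linfZ Al) (linfZ (tl k)) scalerA eps2// scale1r addrC.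
by move/eqP; rewrite addr_eq0 scaleN1r => /eqP.
Qed.

End UniformSign.
End CliffordModules.

(** * Equivalence of spinor representations *)

Section CliffordVectors.
Variables (K : comNzRingType) (V : lmodType K) (q : V -> K).

Lemma clvecD u v : clvec q (u + v) = clvec q u + clvec q v.
Proof. exact: (linfD (clvec_linear q)). Qed.

Lemma clvecN u : clvec q (- u) = - clvec q u.
Proof. exact: (linfN (clvec_linear q)). Qed.

(** The polarisation of v^2 = q(v). *)
Lemma clvec_anticomm u v :
  clvec q u * clvec q v + clvec q v * clvec q u = polar q u v *: (1 : cl q).
Proof.
have := clvec_sq q (u + v); rewrite clvecD mulrDl !mulrDr !clvec_sq /polar.
rewrite !scalerBl => <-.
by rewrite addrA [RHS]addrAC addrK -[X in X - _]addrA [RHS]addrC addKr.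
Qed.

Lemma clalpha_vec v : (forall u, q (- u) = q u) ->
  clalpha (clvec q v) = - clvec q v.
Proof.
move=> qN; rewrite /clalpha clmap_vec ?clvecN// => a u w.
by rewrite opprD scalerN.
Qed.

End CliffordVectors.

Section Representations.
Variables (R : realType) (V : lmodType R) (q : V -> R).
Variables (E : lmodType R[i]) (rho : cl q -> E -> E).
Hypothesis rho_rep : cl_rep rho.

Lemma rep_linear a : linear (rho a). Proof. by have [H _ _ _ _] := rho_rep. Qed.
Lemma repD a b s : rho (a + b) s = rho a s + rho b s.
Proof. by have [_ H _ _ _] := rho_rep. Qed.
Lemma repZ (r : R) a s : rho (r *: a) s = r%:C%C *: rho a s.
Proof. by have [_ _ H _ _] := rho_rep. Qed.
Lemma rep1 s : rho 1 s = s. Proof. by have [_ _ _ H _] := rho_rep. Qed.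
Lemma repM a b s : rho (a * b) s = rho a (rho b s).
Proof. by have [_ _ _ _ H] := rho_rep. Qed.

Lemma rep_sclr (r : R) s : rho (r *: (1 : cl q)) s = r%:C%C *: s.
Proof. by rewrite repZ rep1. Qed.

Lemma rep0 s : rho 0 s = 0.
Proof. by rewrite -(scale0r (0 : cl q)) repZ rmorph0 scale0r. Qed.

Lemma repN a s : rho (- a) s = - rho a s.
Proof. by rewrite -[- a]scaleN1r repZ rmorphN1 scaleN1r. Qed.

Lemma rep_anticomm u v s :
  rho (clvec q u) (rho (clvec q v) s) + rho (clvec q v) (rho (clvec q u) s) =
  (polar q u v)%:C%C *: s.
Proof. by rewrite -!repM -repD clvec_anticomm rep_sclr. Qed.

Lemma rep_sq v s : rho (clvec q v) (rho (clvec q v) s) = (q v)%:C%C *: s.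
Proof. by rewrite -repM clvec_sq rep_sclr. Qed.

Lemma rep_vec_sum n (c : 'I_n -> R) (e : 'I_n -> V) s :
  rho (clvec q (\sum_i c i *: e i)) s = \sum_i (c i)%:C%C *: rho (clvec q (e i)) s.
Proof.
rewrite (linf_sum (clvec_linear q)); elim: (index_enum _) => [|i r IH].
  by rewrite !big_nil rep0.
by rewrite !big_cons repD IH (linfZ (clvec_linear q)) repZ.
Qed.

Lemma rep_clifford_ops n (e : nat -> V) (eps : nat -> R) :
  (forall i, (i < n)%N -> q (e i) = eps i) ->
  (forall i j, (i < n)%N -> (j < n)%N -> i != j -> polar q (e i) (e j) = 0) ->
  clifford_ops n (fun i => (eps i)%:C%C) (fun i => rho (clvec q (e i))).
Proof.
move=> qe eO; split=> [i|i s ik|i j s ik jk ij]; first exact: rep_linear.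
  by rewrite rep_sq qe.
have := rep_anticomm (e i) (e j) s; rewrite eO// rmorph0 scale0r.
by move/eqP; rewrite addr_eq0 => /eqP.
Qed.

End Representations.

(** Kernel and image of [A] are invariant subspaces as soon as [A] carries the two
    sets of operators into each other, even if it does not intertwine them along a
    fixed isomorphism; this is the case for an intertwiner up to sign. *)
Lemma schur (R : realType) (V W : lmodType R) (q : V -> R) (q' : W -> R)
    (E E' : lmodType R[i]) (rho : cl q -> E -> E) (tau : cl q' -> E' -> E')
    (D : set (cl q)) (D' : set (cl q')) (A : E -> E') :
  cl_rep rho -> cl_rep tau -> irreducible_on D rho -> irreducible_on D' tau ->
  linear A -> (exists s, A s != 0) ->
  (forall a, exists b, forall s, A (rho a s) = tau b (A s)) ->
  (forall b, exists a, forall s, tau b (A s) = A (rho a s)) ->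
  bijective A.
Proof.
move=> rr tr [_ ri] [_ ti] Al [s0 As0] AD AD'.
have A0 := linf0 Al.
apply: inj_surj_bij => [s t st|t].
  have [||ker0|kerT] := ri [set s | A s = 0].
  - by split=> // c u v /= Au Av; rewrite Al Au Av scaler0 addr0.
  - move=> a u _ /= Au; have [b ->] := AD a; rewrite Au.
    exact: linf0 (rep_linear tr b).
  - have : [set s | A s = 0] (s - t) by rewrite /= (linfB Al) st subrr.
    by rewrite ker0 /= => /subr0_eq.
  - have : [set s | A s = 0] s0 by rewrite kerT.
    by move=> /eqP; rewrite (negPf As0).
have [||im0|imT] := ti (range A).
- split; first by exists 0; rewrite ?A0.
  by move=> c _ _ [u _ <-] [v _ <-]; exists (c *: u + v); rewrite ?Al.
- by move=> b _ _ [u _ <-]; have [a ->] := AD' b; exists (rho a u).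
- have : range A (A s0) by exists s0.
  by rewrite im0 /= => /eqP; rewrite (negPf As0).
- have : range A t by rewrite imT.
  by case=> s _ <-; exists s.
Qed.

Lemma orthonormal_clifford_ops (R : realType) (V : vectType R) (h : V -> R)
    (W : lmodType R) (q : W -> R) (p : V -> W) n e eps (E : lmodType R[i])
    (rho : cl q -> E -> E) :
  nondeg_quadform h -> orthonormal h n e eps -> linear p ->
  (forall v, q (p v) = h v) -> cl_rep rho ->
  clifford_ops n (fun i => (eps i)%:C%C) (fun i => rho (clvec q (p (e i)))).
Proof.
move=> hq [eps2 eO] pl qp rr.
apply: (rep_clifford_ops rr (e := p \o e)) => [i ik|i j ik jk ij] /=.
  rewrite qp; have := eO i i ik ik; rewrite eqxx (polar_diag hq).
  by move/mulfI; apply; rewrite pnatr_eq0.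
by rewrite /polar -(linfD pl) !qp -/(polar h (e i) (e j)) eO// (negPf ij).
Qed.

Lemma orthonormal_complex_sq (R : realType) (V : vectType R) (h : V -> R) n e eps :
  orthonormal h n e eps ->
  forall i, (i < n)%N -> (eps i)%:C%C * (eps i)%:C%C = 1 :> R[i].
Proof. by move=> [eps2 _] i ik; rewrite -rmorphM eps2// rmorph1. Qed.

Lemma dirac_or_cartan_rep (R : realType) (V : lmodType R) (q : V -> R) m
    (E : lmodType R[i]) (rho : cl q -> E -> E) :
  dirac_or_cartan m rho -> cl_rep rho.
Proof. by rewrite /dirac_or_cartan; case: ifP => _ []. Qed.

Section Equivalence.
Variables (R : realType) (V : vectType R) (h : V -> R).
Hypothesis h_quad : nondeg_quadform h.
Variables (W : lmodType R) (q : W -> R) (p : V -> W).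
Hypothesis p_iso : is_isometry h q p.

Section Intertwiner.
Variables (E E' : lmodType R[i]) (rho : cl h -> E -> E) (tau : cl q -> E' -> E').
Hypotheses (rho_rep : cl_rep rho) (tau_rep : cl_rep tau).

Lemma signed_intertwiner (l : E -> R[i]) (s0 : E) (w : E') :
  linear (l : E -> R[i]^o) -> l s0 != 0 -> w != 0 ->
  exists (A : E -> E') (c : R[i]), [/\ linear A, exists s, A s != 0,
    c = 1 \/ c = -1 &
    forall v s, tau (clvec q (p v)) (A s) = c *: A (rho (clvec h v) s)].
Proof.
move=> ll ls w0; have [pl [p' pK p'K] qp] := p_iso.
have [e [eps eO]] := orthonormal_exists h_quad (leqnn (\dim {:V}%VS)).
have [eps2 eO2] := eO; set n := \dim _ in eO eps2 eO2.
have idl : linear (id : V -> V) by [].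
have rC := orthonormal_clifford_ops h_quad eO idl (fun=> erefl) rho_rep.
have tC := orthonormal_clifford_ops h_quad eO pl qp tau_rep.
have eps2' := orthonormal_complex_sq eO.
have A0l : linear (fun s => l s *: w).
  by move=> a u v; rewrite ll scalerDl scalerA.
have A0n : l s0 *: w != 0 by rewrite scaler_eq0 negb_or ls.
have [A [c [Al An c1 Ac]]] := intertwiner_up_to_sign eps2' rC tC A0l A0n.
exists A, c; split=> // v s; rewrite [v](orthonormal_expand h_quad _ eO).
rewrite (linf_sum pl); under eq_bigr => i _ do rewrite (linfZ pl).
rewrite (rep_vec_sum tau_rep) (rep_vec_sum rho_rep) (linf_sum Al) scaler_sumr.
by apply: eq_bigr => i _; rewrite Ac// (linfZ Al) !scalerA mulrC.
Qed.

(** For c = -1 the operator of a product of k vectors is intertwined up to (-1)^k,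
    so that the hypotheses of [schur] hold for both values of c. *)
Lemma signed_intertwiner_bij (D : set (cl h)) (D' : set (cl q)) (A : E -> E')
    (c : R[i]) : irreducible_on D rho -> irreducible_on D' tau ->
  linear A -> (exists s, A s != 0) -> c = 1 \/ c = -1 ->
  (forall v s, tau (clvec q (p v)) (A s) = c *: A (rho (clvec h v) s)) ->
  bijective A.
Proof.
move=> ri ti Al An c1 Ac; have [pl [p' pK p'K] qp] := p_iso.
apply: (schur rho_rep tau_rep ri ti Al An) => a.
  apply: (cl_ind (P := fun a => exists b, forall s, A (rho a s) = tau b (A s))) a.
  - move=> v; case: c1 Ac => -> Ac.
      by exists (clvec q (p v)) => s; rewrite Ac scale1r.
    by exists (- clvec q (p v)) => s; rewrite (repN tau_rep) Ac scaleN1r opprK.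
  - move=> r; exists (r *: (1 : cl q)) => s.
    by rewrite (rep_sclr rho_rep) (rep_sclr tau_rep) (linfZ Al).
  - move=> a b [a' aE] [b' bE]; exists (a' + b') => s.
    by rewrite (repD rho_rep) (repD tau_rep) (linfD Al) aE bE.
  - move=> a b [a' aE] [b' bE]; exists (a' * b') => s.
    by rewrite (repM rho_rep) (repM tau_rep) aE bE.
apply: (cl_ind (P := fun b => exists a, forall s, tau b (A s) = A (rho a s))) a.
- move=> w; rewrite -(p'K w); set v := p' w; case: c1 Ac => -> Ac.
    by exists (clvec h v) => s; rewrite Ac scale1r.
  by exists (- clvec h v) => s; rewrite (repN rho_rep) Ac scaleN1r (linfN Al).
- move=> r; exists (r *: (1 : cl h)) => s.
  by rewrite (rep_sclr rho_rep) (rep_sclr tau_rep) (linfZ Al).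
- move=> a b [a' aE] [b' bE]; exists (a' + b') => s.
  by rewrite (repD rho_rep) (repD tau_rep) (linfD Al) aE bE.
- move=> a b [a' aE] [b' bE]; exists (a' * b') => s.
  by rewrite (repM rho_rep) (repM tau_rep) bE aE.
Qed.

End Intertwiner.

Definition intertwiner (E E' : lmodType R[i]) (rho : cl h -> E -> E)
    (tau : cl q -> E' -> E') (p : V -> W) (f : E -> E') : Prop :=
  [/\ linear f, bijective f &
      forall v s, f (rho (clvec h v) s) = tau (clvec q (p v)) (f s)].

(** The number of generators being even, the volume operator anticommutes with all of
    them, and composing with it changes the common sign. *)
Lemma dirac_equiv (S : vectType R[i]) (E' : lmodType R[i])
    (rho : cl h -> S -> S) (tau : cl q -> E' -> E') :
  ~~ odd (\dim {:V}%VS) -> dirac_rep rho -> dirac_rep tau ->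
  exists f, intertwiner rho tau p f.
Proof.
move=> even [rr _ ri] [tr _ ti].
have [[s0 s00] _] := ri; have [[w w0] _] := ti.
have [l [ll ls]] := nonzero_functional s00.
have [A [c [Al An c1 Ac]]] := signed_intertwiner rr tr ll ls w0.
suff [B [Bl Bn Bc]] : exists B : S -> E', [/\ linear B, exists s, B s != 0 &
    forall v s, tau (clvec q (p v)) (B s) = 1 *: B (rho (clvec h v) s)].
  exists B; split=> // [|v s]; last by rewrite Bc scale1r.
  exact: (signed_intertwiner_bij rr tr ri ti Bl Bn (or_introl erefl) Bc).
case: c1 Ac => -> Ac; first by exists A.
have [e [eps eO]] := orthonormal_exists h_quad (leqnn (\dim {:V}%VS)).
have [eps2 eO2] := eO; set n := \dim _ in even eO eps2 eO2.
have idl : linear (id : V -> V) by [].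
have rC := orthonormal_clifford_ops h_quad eO idl (fun=> erefl) rr.
have eps2' := orthonormal_complex_sq eO.
have [eta [etal [eta' etas] etaE]] := volume_operator eps2' rC.
have etav v s : eta (rho (clvec h v) s) = - rho (clvec h v) (eta s).
  rewrite [v](orthonormal_expand h_quad _ eO) !(rep_vec_sum rr) (linf_sum etal) -sumrN.
  apply: eq_bigr => i _; rewrite (linfZ etal) etaE//.
  by rewrite exprS mulN1r -signr_odd (negPf even) expr0 scaleN1r scalerN.
exists (A \o eta); split; first exact: linear_comp.
- by have [s As] := An; exists (eta' s); rewrite /= etas.
- by move=> v s; rewrite /= Ac etav (linfN Al) scaleN1r scale1r.
Qed.

(** Let J and L be the decompositions of the two modules, and A the isomorphism up to
    a sign c of the Pauli representations. A vector v acts on the two summands by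
    sigma(v) and -sigma(v), so the direct sum of two copies of A is an intertwiner for
    c = 1, and its composition with the exchange of the summands is one for c = -1. *)
Lemma cartan_equiv (S : vectType R[i]) (E' : lmodType R[i])
    (rho : cl h -> S -> S) (tau : cl q -> E' -> E') :
  cartan_rep rho -> cartan_rep tau -> exists f, intertwiner rho tau p f.
Proof.
move=> [rr [S0 [sigma [J [[sr _ si] Jl [J' JK J'K] JE]]]]].
move=> [tr [T0 [sigma' [L [[sr' _ si'] Ll [L' LK L'K] LE]]]]].
have [[s0 s00] _] := si; have [[w w0] _] := si'.
have Js0 : J (s0, 0) != 0.
  apply/eqP => J0; have : (s0, 0) = 0 :> S0 * S0.
    by apply: (can_inj JK); rewrite J0 (linf0 Jl).
  by case=> /eqP; rewrite (negPf s00).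
have [l [ll ls]] := nonzero_functional Js0.
have l0l : linear ((fun s => l (J (s, 0))) : S0 -> R[i]^o).
  move=> a u v; rewrite -ll -Jl; congr (l (J _)).
  by congr (_, _); rewrite /= scaler0 addr0.
have [A [c [Al An c1 Ac]]] := signed_intertwiner sr sr' l0l ls w0.
have [A' AK A'K] := signed_intertwiner_bij sr sr' si si' Al An c1 Ac.
have hN v : h (- v) = h v by rewrite -scaleN1r (quadZ h_quad) sqrrN expr1n mul1r.
have qN y : q (- y) = q y.
  have [pl [p' pK p'K] qp] := p_iso.
  by rewrite -(p'K y) -(linfN pl) !qp hN.
have rhoJ v s t : rho (clvec h v) (J (s, t)) =
    J (sigma (clvec h v) s, - sigma (clvec h v) t).
  by rewrite -JE clalpha_vec ?(repN sr)//; exact: hN.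
have tauL v s t : tau (clvec q (p v)) (L (s, t)) =
    L (sigma' (clvec q (p v)) s, - sigma' (clvec q (p v)) t).
  by rewrite -LE clalpha_vec ?(repN sr')//; exact: qN.
have J'l := linear_inv JK J'K Jl.
case: c1 Ac => -> Ac.
  exists (fun s => L (A (J' s).1, A (J' s).2)); split.
  - move=> a u v; rewrite J'l -Ll; congr L.
    by congr (_, _) => /=; rewrite Al.
  - exists (fun t => J (A' (L' t).1, A' (L' t).2)) => s.
      by rewrite LK /= !AK -surjective_pairing J'K.
    by rewrite JK /= !A'K -surjective_pairing L'K.
  - move=> v s; rewrite -(J'K s); case: (J' s) => s1 s2.
    by rewrite rhoJ !JK /= tauL !Ac !scale1r (linfN Al).
exists (fun s => L (A (J' s).2, A (J' s).1)); split.
- move=> a u v; rewrite J'l -Ll; congr L.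
  by congr (_, _) => /=; rewrite Al.
- exists (fun t => J (A' (L' t).2, A' (L' t).1)) => s.
    by rewrite LK /= !AK -surjective_pairing J'K.
  by rewrite JK /= !A'K -surjective_pairing L'K.
- move=> v s; rewrite -(J'K s); case: (J' s) => s1 s2.
  by rewrite rhoJ !JK /= tauL !Ac !scaleN1r (linfN Al) opprK.
Qed.

Lemma spinor_equiv m (S : vectType R[i]) (E' : lmodType R[i])
    (rho : cl h -> S -> S) (tau : cl q -> E' -> E') : \dim {:V}%VS = m ->
  dirac_or_cartan m rho -> dirac_or_cartan m tau ->
  exists f, intertwiner rho tau p f.
Proof.
move=> dimV; rewrite /dirac_or_cartan; case: ifP => om.
  exact: cartan_equiv.
by apply: dirac_equiv; rewrite dimV om.
Qed.

End Equivalence.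

(** An intertwiner for vectors is one for the whole Clifford algebra, which the
    vectors generate. *)
Lemma clmap_intertwine (R : realType) (V W : lmodType R) (h : V -> R) (q : W -> R)
    (p : V -> W) (p' : W -> V) (E E' : lmodType R[i])
    (rho : cl h -> E -> E) (tau : cl q -> E' -> E') (f : E -> E') :
  cl_rep rho -> cl_rep tau -> linear f -> linear p' -> cancel p' p ->
  (forall w, h (p' w) = q w) ->
  (forall v s, f (rho (clvec h v) s) = tau (clvec q (p v)) (f s)) ->
  forall a s, f (rho (clmap q h p' a) s) = tau a (f s).
Proof.
move=> rr tr fl p'l p'K hp' fE.
have [_ cD cM c1 cZ] : [/\ True, {morph clmap q h p' : a b / a + b},
    {morph clmap q h p' : a b / a * b}, clmap q h p' 1 = 1 &
    forall (r : R) a, clmap q h p' (r *: a) = (r *: (1 : cl h)) * clmap q h p' a].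
  have [] := @clift_morph _ _ q (cl h : pzRingType) (fun r : R => r *: (1 : cl h))
     (fun v => clvec h (p' v)).
  - by rewrite scale0r.
  - by rewrite scale1r.
  - by move=> r s; rewrite scalerDl.
  - by move=> r s; rewrite -cl_scaleAl mul1r scalerA.
  - by move=> r x; rewrite -cl_scaleAl -cl_scaleAr mul1r mulr1.
  - by move=> u w; rewrite (linfD p'l) clvecD.
  - by move=> r u; rewrite (linfZ p'l) (linfZ (clvec_linear h)) -cl_scaleAl mul1r.
  - by move=> u; rewrite clvec_sq hp'.
  by move=> _ ? ? ? ?; split.
apply: cl_ind => [w|r|a b IHa IHb|a b IHa IHb] s.
- by rewrite clmap_vec// fE p'K.
- by rewrite cZ c1 mulr1 (rep_sclr rr) (rep_sclr tr) (linfZ fl).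
- by rewrite cD (repD rr) (repD tr) (linfD fl) IHa IHb.
- by rewrite cM (repM rr) (repM tr) IHa IHb.
Qed.

(** * Local spinor frames *)

Lemma quad_expand (R : realType) (V : vectType R) (h : V -> R) (e : nat -> V)
    (eps : nat -> R) v (c := fun i => eps i / 2 * polar h v (e i)) :
  nondeg_quadform h -> orthonormal h (\dim {:V}%VS) e eps ->
  h v = \sum_(i < \dim {:V}%VS) c i * c i * eps i.
Proof.
move=> hq eO; have [eps2 _] := eO.
apply: (@mulfI _ 2); first by rewrite pnatr_eq0.
rewrite -(polar_diag hq) {2}(orthonormal_expand hq v eO).
rewrite (linf_sum (polar_linear hq v)) mulr_sumr; apply: eq_bigr => i _.
rewrite (polarZr hq) /c; set p := polar h v _.
transitivity (2^-1 * (eps i * eps i) * (eps i * p * p)); last by field.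
by rewrite eps2//; field.
Qed.

Section SpinorFrames.
Variables (R : realType) (m : nat) (M : manifold R m) (g : metric M).
Variables (V : vectType R) (h : V -> R).
Hypothesis dimV : \dim {:V}%VS = m.
Hypothesis h_quad : nondeg_quadform h.
Hypothesis local_model : forall x : M,
  exists f : V -> tangent x, is_isometry h (gquad g x) f.

Lemma gquad_polar x (u v : tangent x) : polar (gquad g x) u v = 2 * g x u v.
Proof.
rewrite /polar /gquad (linfD (gform_linear_l g _)) !(linfD (gform_linear_r g _)).
by rewrite (g_sym _ v u); ring.
Qed.

(** Non-degeneracy makes an isometry injective; surjectivity is a matter of
    dimension, read off after composing with the inverse of a given isometry. *)
Lemma linear_isometry_bij x (P : V -> tangent x) : linear P ->
  (forall v, gquad g x (P v) = h v) -> is_isometry h (gquad g x) P.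
Proof.
move=> Pl Pq; split=> //; have [f [fl [f' fK f'K] fq]] := local_model x.
have [_ _ nondeg] := h_quad.
have f'l := linear_inv fK f'K fl.
have Pi : injective P.
  move=> u v uv; apply/subr0_eq/nondeg => w.
  rewrite /polar -!Pq (linfD Pl) -/(polar (gquad g x) _ _) gquad_polar.
  by rewrite (linfB Pl) uv subrr (linf0 (gform_linear_l g _)) mulr0.
have Fl : linear (f' \o P) by exact: linear_comp.
have FE := linear_linfunE Fl.
have F0 : lker (linfun (f' \o P)) == 0%VS.
  by apply/lker0P => u v; rewrite !FE /= => /(can_inj f'K)/Pi.
exists (fun w => (linfun (f' \o P))^-1%VF (f' w)) => [v|w].
  by rewrite -[f' (P v)]FE lker0_lfunK.
apply: (can_inj f'K); rewrite -[f' (P _)]FE.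
by rewrite lker0_lfunVK.
Qed.

Lemma isometry_oframe x (P : V -> tangent x) : is_isometry h (gquad g x) P ->
  exists q : oframe g h x, frame q = P.
Proof.
by move=> [Pl [P' PK P'K] Pq]; exists (OFrame Pl PK P'K Pq).
Qed.

Lemma oframe_isometry x (q : oframe g h x) : is_isometry h (gquad g x) q.
Proof.
by case: q => P P' Pl PK P'K Pq; split=> //; exists P'.
Qed.

Variables (S : vectType R[i]) (rho : cl h -> S -> S).
Hypothesis S_spin : spin_space m rho.
Variable Sigma : faithful_spinor_bundle g.

(** These pairs are the points of the fibre over [x] of the principal bundle to be
    constructed. *)
Definition spinor_frame x (q : oframe g h x) (phi : S -> Sigma x) : Prop :=
  intertwiner rho (@stau _ _ _ _ Sigma x) q phi.

Lemma spinor_frame_exists x : exists (q : oframe g h x) (phi : S -> Sigma x),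
  spinor_frame q phi.
Proof.
have [f fi] := local_model x; have [q qE] := isometry_oframe fi.
have [S_rep _] := S_spin.
have [phi phiE] := spinor_equiv h_quad (oframe_isometry q) dimV S_rep
  (stau_spin Sigma x).
by exists q, phi.
Qed.

Definition smooth_spinor_frame (U : set M) (q : forall x, oframe g h x)
    (phi : forall x, S -> Sigma x) : Prop :=
  [/\ forall v, smooth_vfield U (fun x => q x v),
      forall x, U x -> spinor_frame (q x) (phi x) &
      forall k : triv Sigma, exists2 c : M -> 'Hom(S, typical Sigma),
        hsmooth (U `&` tdom k) c &
        forall x, U x -> tdom k x -> forall s, c x s = tmap k (phi x s)].

(** The isometry [q x] maps the orthonormal basis [e] of V to the vectors [X i x], as
    the coefficients are the coordinates of v in this basis. *)
Lemma smooth_oframe_exists (x0 : M) (q0 : oframe g h x0) (e : nat -> V)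
    (eps : nat -> R) (n := \dim {:V}%VS) : orthonormal h n e eps ->
  exists (U : set M) (X : nat -> vfield M) (q : forall x, oframe g h x),
  [/\ open U, U x0, forall i, smooth_vfield U (X i),
      forall i, (i < n)%N -> X i x0 = q0 (e i) &
      forall x, U x -> forall v,
        q x v = \sum_(i < n) (eps i / 2 * polar h v (e i)) *: X i x].
Proof.
move=> eO; have [eps2 eO2] := eO.
have eg i j : (i < n)%N -> (j < n)%N ->
    g x0 (q0 (e i)) (q0 (e j)) = if i == j then eps i else 0.
  move=> ik jk; apply: (@mulfI _ 2); first by rewrite pnatr_eq0.
  have [ql _ qq] := oframe_isometry q0.
  rewrite -gquad_polar /polar -(linfD ql) !qq -/(polar h (e i) (e j)) eO2//.
  by case: ifP => //; rewrite mulr0.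
have [U [X [oU Ux0 Xs Xe XO]]] := orthonormal_frame (e := fun i => q0 (e i)) eps2 eg.
pose P x v := \sum_(i < n) (eps i / 2 * polar h v (e i)) *: X i x.
have Pq x : exists q : oframe g h x, U x -> forall v, q v = P x v.
  have [Ux|nUx] := pselect (U x); last first.
    have [f /isometry_oframe[q _]] := local_model x; by exists q.
  suff /isometry_oframe[q qE] : is_isometry h (gquad g x) (P x).
    by exists q => _ v; rewrite qE.
  apply: linear_isometry_bij => [a u v|v].
    rewrite /P scaler_sumr -big_split; apply: eq_bigr => i _ /=.
    rewrite scalerA -scalerDl; congr (_ *: _).
    rewrite !(polarC _ _ (e i)) (polar_linear h_quad (e i)).
    by rewrite -[_ *: polar _ _ _]/(_ * _); ring.
  rewrite (quad_expand v h_quad eO) /gquad {1}/P.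
  rewrite (linf_sum (gform_linear_l g _)); apply: eq_bigr => i _.
  rewrite gformZl /P (linf_sum (gform_linear_r g _)) (bigD1 i)//= big1 ?addr0; last first.
    move=> j ji; rewrite gformZr XO// ifN ?mulr0// eq_sym.
    by move: ji; rewrite -(inj_eq val_inj).
  by rewrite gformZr XO// eqxx mulrA.
exists U, X, (fun x => sval (cid (Pq x))); split=> // x Ux v.
by case: cid => q qE /=; exact: qE.
Qed.

Lemma clifford_ops_transport (K : fieldType) n (a : nat -> K) (E E' : lmodType K)
    (rho' : nat -> E -> E) (tau' : nat -> E' -> E') (t : E -> E') :
  linear t -> bijective t -> (forall i, linear (tau' i)) ->
  (forall i s, (i < n)%N -> t (rho' i s) = tau' i (t s)) ->
  clifford_ops n a rho' -> clifford_ops n a tau'.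
Proof.
move=> tl [t' tK t'K] taul tE [_ rr ra]; split=> // [i s ik|i j s ik jk ij].
  by rewrite -(t'K s) -!tE// rr// (linfZ tl).
by rewrite -(t'K s) -!tE// ra// (linfN tl).
Qed.

(** The average of a constant family of maps over a smooth orthonormal frame is smooth,
    consists of intertwiners and has the same value at [x0], where the given map is
    an intertwiner already. *)
Lemma smooth_spinor_frame_exists (x0 : M) :
  exists U (q : forall x, oframe g h x) (phi : forall x, S -> Sigma x),
    [/\ open U, U x0 & smooth_spinor_frame U q phi].
Proof.
have [q0 [phi0 [phi0l phi0b phi0E]]] := spinor_frame_exists x0.
have [e [eps eO]] := orthonormal_exists h_quad (leqnn (\dim {:V}%VS)).
have [U [X [q [oU Ux0 Xs Xe qX]]]] := smooth_oframe_exists q0 eO.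
have [eps2 eO2] := eO; set n := \dim _ in eO eps2 eO2 Xe qX.
have rr := dirac_or_cartan_rep (proj1 S_spin).
have qe x : U x -> forall i, (i < n)%N -> q x (e i) = X i x.
  move=> Ux i ik; rewrite qX// (bigD1 (Ordinal ik))//= big1 => [|j ji].
    rewrite eO2// eqxx addr0 (_ : _ * _ = eps i * eps i); last by field.
    by rewrite eps2// scale1r.
  rewrite eO2// ifN ?mulr0 ?scale0r// eq_sym.
  by move: ji; rewrite -(inj_eq val_inj).
have [k kx0] := tdom_cover Sigma x0.
pose W := U `&` tdom k; have oW : open W := openI oU (@tdom_open _ _ _ _ k).
have Wx0 : W x0 by [].
have tl x : W x -> linear (tmap k (x := x)) by move=> [_ /(@tmap_linear _ _ _ Sigma k)].
have tb x : W x -> bijective (tmap k (x := x)) by move=> [_ /(@tmap_bij _ _ _ Sigma k)].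
(* c i is the action of the vector field X i, read in the trivialisation k *)
have /choice[c cP] : forall i, exists c : M -> 'End(typical Sigma), hsmooth W c /\
    forall x, W x -> forall s,
      tmap k (stau (clvec (gquad g x) (X i x)) s) = c x (tmap k s).
  move=> i; have [_ /(_ k k)[c cs cE]] := stau_smooth Sigma oU (clsection_vec g (Xs i)).
  exists c; split=> [|x [Ux kx] s]; last exact: cE.
  by apply: hsmooth_sub cs => x [].
pose r i := linfun (rho (clvec h (e i))).
have rE i s : r i s = rho (clvec h (e i)) s by exact/linear_linfunE/rep_linear.
have idl : linear (id : V -> V) by [].
have rC := orthonormal_clifford_ops h_quad eO idl (fun=> erefl) rr.
have tC x : W x -> clifford_ops n (fun i => (eps i)%:C%C) (fun i => c i x).
  move=> Wx; have [Ux _] := Wx; have [ql _ qq] := oframe_isometry (q x).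
  have := orthonormal_clifford_ops h_quad eO ql qq (stau_rep Sigma x).
  apply: (clifford_ops_transport (tl x Wx) (tb x Wx)) => [i|i s ik].
    by move=> a u v; exact: linearP.
  by rewrite qe//; have [_ ->] := cP i.
have eps2' := orthonormal_complex_sq eO.
pose A0 := linfun (tmap k (x := x0) \o phi0).
have A0E s : A0 s = tmap k (phi0 s).
  by rewrite linear_linfunE//; exact: linear_comp (tl x0 Wx0) phi0l.
have [A [As Ax0 Ac]] : exists A : M -> 'Hom(S, typical Sigma),
    [/\ hsmooth W A, A x0 = A0 & forall x, W x -> forall i s, (i < n)%N ->
        c i x (A x s) = A x (rho (clvec h (e i)) s)].
  have A0c i s : (i < n)%N -> c i x0 (A0 s) = A0 (rho (clvec h (e i)) s).
    by move=> ik; rewrite !A0E phi0E; have [_ <-] := cP i; rewrite ?Xe.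
  suff H j : (j <= n)%N -> exists A : M -> 'Hom(S, typical Sigma),
    [/\ hsmooth W A, A x0 = A0 & forall x, W x -> forall i s, (i < j)%N ->
        c i x (A x s) = A x (rho (clvec h (e i)) s)] by exact: H.
  elim: j => [_|j IH jn]; first by exists (fun=> A0); split=> //; exact: hsmooth_cst.
  have [A [As Ax0 Ac]] := IH (ltnW jn).
  (* the factor 1/2 ensures that the value at x0, an intertwiner, is its own average *)
  exists (fun x => 2^-1 *: (A x + (eps j)%:C%C *: (c j x \o (A x \o r j)))%VF).
  have BE x s : (2^-1 *: (A x + (eps j)%:C%C *: (c j x \o (A x \o r j))))%VF s =
      2^-1 *: (A x s + (eps j)%:C%C *: c j x (A x (rho (clvec h (e j)) s))).
    by rewrite scale_lfunE add_lfunE scale_lfunE !comp_lfunE rE.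
  split.
  - apply: hsmooth_scale => //; apply: hsmooth_add => //.
    apply: hsmooth_scale => //; apply: hsmooth_comp => //; first by have [] := cP j.
    exact: hsmooth_comp As (hsmooth_cst _ _).
  - apply/lfunP => s; rewrite BE Ax0 A0c//; have [_ rsq _] := rC.
    rewrite rsq// (linearZZ A0) scalerA eps2'// scale1r -[A0 s + _]/(A0 s *+ 2).
    by rewrite -scaler_nat scalerA mulVf ?scale1r// pnatr_eq0.
  - move=> x Wx; have Al : linear (A x) by move=> a u v; exact: linearP.
    have Ac1 i s : (i < j)%N -> c i x (A x s) = 1 *: A x (rho (clvec h (e i)) s).
      by move=> ij; rewrite scale1r Ac.
    have [_ Bc Bj] := average_intertwines eps2' rC (tC x Wx) jn Al Ac1.
    move=> i s; rewrite !BE linearZZ ltnS leq_eqVlt => /predU1P[->|ij].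
      congr (_ *: _); exact: Bj.
    by congr (_ *: _); rewrite -[RHS]scale1r; exact: Bc.
have A0b : bijective (A x0).
  have [t' tK t'K] := tb x0 Wx0; have [phi' pK p'K] := phi0b.
  by rewrite Ax0; exists (phi' \o t') => s /=; rewrite A0E ?tK ?p'K.
have [U' [oU' U'x0 U'W Ab]] := hsmooth_bij_open oW Wx0 A0b As.
have phiP x : exists phi : S -> Sigma x, U' x -> forall s, tmap k (phi s) = A x s.
  have [/U'W/tb[t' tK t'K]|nU'x] := pselect (U' x); last by exists (fun=> 0).
  by exists (t' \o A x) => _ s /=; rewrite t'K.
pose phi x := sval (cid (phiP x)).
have phiE x s : U' x -> tmap k (phi x s) = A x s.
  by rewrite /phi; case: cid => f fE /= /fE.
have U'U : U' `<=` U by move=> x /U'W[].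
have U'k : U' `<=` tdom k by move=> x /U'W[].
exists U', q, phi; split=> //; split=> [v|x U'x|j].
- have qs : smooth_vfield U' (fun x => \sum_(i < n) (eps i / 2 * polar h v (e i)) *: X i x).
    apply: vfield_smooth_sum => // i; apply: vfield_smooth_scale => //.
      exact: msmooth_cst.
    exact: vfield_smooth_sub U'U (Xs i).
  by apply: vfield_smooth_ext qs => // x U'x; rewrite qX//; exact: U'U.
- have Ux := U'U x U'x; have Wx := U'W x U'x.
  have ti : injective (tmap k (x := x)) by exact/bij_inj/tb.
  split.
  + by move=> a u v; apply: ti; rewrite (tl x Wx) !phiE// linearP.
  + have [t' tK t'K] := tb x Wx; have [A' AK A'K] := Ab x U'x.
    exists (A' \o tmap k (x := x)) => s /=; first by rewrite phiE.
    by apply: ti; rewrite phiE.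
  + move=> v s; apply: ti; rewrite phiE// {1}(orthonormal_expand h_quad v eO).
    rewrite (rep_vec_sum rr) linear_sum qX// (rep_vec_sum (stau_rep Sigma x)).
    rewrite (linf_sum (tl x Wx)); apply: eq_bigr => i _.
    rewrite linearZZ (linfZ (tl x Wx)); congr (_ *: _).
    by have [_ ->//] := cP i; rewrite phiE// Ac.
- have [d ds dE] := tmap_smooth k j; exists (fun x => (d x \o A x)%VF).
    apply: hsmooth_comp.
    - by apply: openI => //; exact: tdom_open.
    - by apply: hsmooth_sub ds => x [/U'k].
    - by apply: hsmooth_sub As => x [/U'W].
  move=> x U'x jx s; rewrite comp_lfunE -phiE// dE//; exact: U'k.
Qed.

End SpinorFrames.

(** * The Lipschitz group *)

Section LpinGroup.
Variables (R : realType) (V : vectType R) (h : V -> R).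
Hypothesis h_quad : nondeg_quadform h.
Variables (S : vectType R[i]) (rho : cl h -> S -> S).
Hypothesis rho_rep : cl_rep rho.
Variable s0 : S.
Hypothesis s0_neq0 : s0 != 0.

Lemma real_scale_inj (a b : R) : a%:C%C *: s0 = b%:C%C *: s0 -> a = b.
Proof.
move/eqP; rewrite -subr_eq0 -scalerBl scaler_eq0 (negPf s0_neq0) orbF subr_eq0.
by move=> /eqP[].
Qed.

(** Anticommutators recover the polar form, which is non-degenerate. *)
Lemma rep_vec_inj u w :
  (forall s, rho (clvec h u) s = rho (clvec h w) s) -> u = w.
Proof.
move=> uw; apply/subr0_eq; have [_ _ nondeg] := h_quad; apply: nondeg => v.
have uw0 s : rho (clvec h (u - w)) s = 0.
  by rewrite clvecD clvecN (repD rho_rep) (repN rho_rep) uw subrr.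
apply: real_scale_inj; rewrite -(rep_anticomm rho_rep) !uw0.
by rewrite (linf0 (rep_linear rho_rep _)) addr0 rmorph0 scale0r.
Qed.

Lemma AdE (a : lpin rho) v s :
  rho (clvec h (Ad a v)) (lpin_val a s) = lpin_val a (rho (clvec h v) s).
Proof. by rewrite AdP /conj_vec lpin_valVK. Qed.

Lemma Ad_eqP (a : lpin rho) v w :
  (forall s, rho (clvec h w) (lpin_val a s) = lpin_val a (rho (clvec h v) s)) ->
  Ad a v = w.
Proof.
by move=> H; apply: rep_vec_inj => s; rewrite -(lpin_valK a s) AdE H.
Qed.

Lemma AdM (a b : lpin rho) v : Ad (a * b)%g v = Ad a (Ad b v).
Proof. by apply: Ad_eqP => s; rewrite /= !comp_lfunE !AdE. Qed.

Lemma Ad1 v : Ad (1%g : lpin rho) v = v.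
Proof. by apply: Ad_eqP => s; rewrite /= !id_lfunE. Qed.

Lemma AdK (a : lpin rho) : cancel (Ad a) (Ad a^-1%g).
Proof. by move=> v; rewrite -AdM mulVg Ad1. Qed.

Lemma AdVK (a : lpin rho) : cancel (Ad a^-1%g) (Ad a).
Proof. by move=> v; rewrite -AdM mulgV Ad1. Qed.

Lemma Ad_linear (a : lpin rho) : linear (Ad a).
Proof.
move=> c u v; apply: Ad_eqP => s.
rewrite !(clvec_linear h) (repD rho_rep) !(repZ rho_rep) !AdE.
rewrite (repD rho_rep) (repZ rho_rep).
by rewrite linearP.
Qed.

Lemma Ad_isometric (a : lpin rho) v : h (Ad a v) = h v.
Proof.
apply: real_scale_inj; rewrite -!(rep_sq rho_rep).
rewrite -{1}(lpin_valK a s0) !AdE !(rep_sq rho_rep) linearZZ.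
by congr (_ *: _); exact: lpin_valK.
Qed.

End LpinGroup.

(** * The bundle of spinor frames *)

Section Assembly.
Variables (R : realType) (m : nat) (M : manifold R m) (g : metric M).
Variables (V : vectType R) (h : V -> R).
Hypothesis h_quad : nondeg_quadform h.
Variables (S : vectType R[i]) (rho : cl h -> S -> S).
Hypothesis rho_rep : cl_rep rho.
Variable s0 : S.
Hypothesis s0_neq0 : s0 != 0.
Variable Sigma : faithful_spinor_bundle g.

(** The element is a = phi'^-1 phi, which conjugates v into q'^-1 (q v). *)
Lemma spinor_frame_transition x (q q' : oframe g h x) (phi phi' : S -> Sigma x) :
  spinor_frame rho q phi -> spinor_frame rho q' phi' ->
  exists a : lpin rho, (forall s, phi' (lpin_val a s) = phi s) /\
    forall v, q' (Ad a v) = q v.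
Proof.
move=> [fl [f' fK f'K] fE] [f1l [f1' f1K f1'K] f1E].
have f'l := linear_inv fK f'K fl; have f1'l := linear_inv f1K f1'K f1l.
have al : linear (f1' \o phi) by exact: linear_comp.
pose a : 'End(S) := linfun (f1' \o phi).
have aE s : a s = f1' (phi s) by rewrite linear_linfunE.
have a0 : lker a == 0%VS.
  by apply/lker0P => s t; rewrite !aE => /(can_inj f1'K)/(can_inj fK).
have arho v s : a (rho (clvec h v) s) = rho (clvec h (frame_inv q' (q v))) (a s).
  by apply: (can_inj f1K); rewrite f1E !aE !f1'K frame_invK fE.
have La : is_lpin rho a.
  apply: is_lpinI => // v.
  - exists (frame_inv q' (q v)) => s.
    by rewrite arho -[X in rho _ X](lker0_lfunVK a0).
  - exists (frame_inv q (q' v)) => s.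
    by rewrite arho frame_invK frameK lker0_lfunVK.
exists (Lpin (asboolT La)); split=> [s|v].
  by rewrite /= aE f1'K.
apply: (can_inj (frame_invK q')); rewrite frameK.
by apply: (Ad_eqP h_quad rho_rep s0_neq0) => s; rewrite /= arho.
Qed.

Variables (q0 : forall x, oframe g h x) (f0 : forall x, S -> Sigma x).
Hypothesis f0_frame : forall x, spinor_frame rho (q0 x) (f0 x).
Variables (U : M -> set M) (q : M -> forall x, oframe g h x).
Variable phi : M -> forall x, S -> Sigma x.
Hypothesis U_open : forall j, open (U j).
Hypothesis U_self : forall j, U j j.
Hypothesis phi_smooth : forall j, smooth_spinor_frame rho (U j) (q j) (phi j).

Lemma phi_frame j x : U j x -> spinor_frame rho (q j x) (phi j x).
Proof. by move=> jx; have [_ H _] := phi_smooth j; exact: H. Qed.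

Lemma trans_exists j x : exists a : lpin rho, U j x ->
  (forall s, phi j x (lpin_val a s) = f0 x s) /\ forall v, q j x (Ad a v) = q0 x v.
Proof.
have [jx|njx] := pselect (U j x); last by exists 1%g.
by have [a aE] := spinor_frame_transition (f0_frame x) (phi_frame jx); exists a.
Qed.

(** On [U j] this is phi_j^-1 f0, the coordinate of the chosen frame f0 with respect
    to the smooth local frame phi_j; elsewhere it is arbitrary. *)
Definition trans j x : lpin rho := sval (cid (trans_exists j x)).

Lemma trans_phi j x s : U j x -> phi j x (lpin_val (trans j x) s) = f0 x s.
Proof. by rewrite /trans; case: cid => a aE /aE[]. Qed.

Lemma trans_q j x v : U j x -> q j x (Ad (trans j x) v) = q0 x v.
Proof. by rewrite /trans; case: cid => a aE /aE[]. Qed.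

Lemma trans_mul_bij j x : U j x -> bijective (fun a => (trans j x * a)%g).
Proof.
by move=> _; exists (fun a => ((trans j x)^-1 * a)%g) => a; rewrite mulgA ?mulVg ?mulgV mul1g.
Qed.

(** The fibres of Sigma vary with the point. The trivialisation [k] turns the local
    frame into a function with values in a fixed space of linear maps, where inverses
    can be formed smoothly. *)
Lemma local_frame_hom j (k : triv Sigma) : exists C : M -> 'Hom(S, typical Sigma),
  [/\ hsmooth (U j `&` tdom k) C,
      forall x, U j x -> tdom k x -> forall s, C x s = tmap k (phi j x s) &
      forall x, U j x -> tdom k x -> bijective (C x)].
Proof.
have [_ _ /(_ k)[C Cs CE]] := phi_smooth j; exists C; split=> // x jx kx.
have [_ [f' fK f'K] _] := phi_frame jx; have [t' tK t'K] := tmap_bij kx.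
exists (f' \o t') => s /=; first by rewrite CE// tK fK.
by rewrite CE// f'K t'K.
Qed.

(** The pointwise frame f0, which need not depend smoothly on the point, cancels from
    (phi_j^-1 f0) (phi_i^-1 f0)^-1 = phi_j^-1 phi_i. *)
Lemma trans_smooth i j : hsmooth (U i `&` U j)
  (fun x => lpin_val (trans j x * (trans i x)^-1)%g).
Proof.
apply: hsmooth_local => x [ix jx]; have [k kx] := tdom_cover Sigma x.
have [Ci [Cis CiE Cib]] := local_frame_hom i k.
have [Cj [Cjs CjE Cjb]] := local_frame_hom j k.
pose N := (U i `&` U j) `&` tdom k.
have oN : open N by apply: openI (tdom_open _); exact: openI.
exists N => //.
have Ci' : hsmooth N Ci by apply: hsmooth_sub Cis => y [[]].
have Cj' : hsmooth N (fun y => (Cj y)^-1%VF).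
  apply: hsmooth_inv => //; first by move=> y [[_ jy] ky]; exact: Cjb.
  by apply: hsmooth_sub Cjs => y [[]].
apply: hsmooth_ext (hsmooth_comp oN Cj' Ci') => // y [[iy jy] ky].
apply/lfunP => s; have [B CB BC] := Cjb y jy ky.
rewrite comp_lfunE (inv_lfunP CB BC); apply: (can_inj CB); rewrite BC.
rewrite CiE// CjE//; congr (tmap k _).
by rewrite /= comp_lfunE trans_phi// -(trans_phi _ iy) lpin_valK.
Qed.

Lemma trans_cocycle i j : exists2 c : M -> lpin rho,
  gsmooth (@lpin_val _ _ _ _ rho) (U i `&` U j) c &
  forall x, U i x -> U j x ->
    forall a : lpin rho, (trans j x * a = c x * (trans i x * a))%g.
Proof.
exists (fun x => trans j x * (trans i x)^-1)%g; first exact: trans_smooth.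
by move=> x _ _ a; rewrite -mulgA mulKg.
Qed.

(** The element a of the fibre over x stands for the spinor frame f0 a, which has the
    coordinate (phi_j^-1 f0) a in the trivialisation j. The trivialisations are indexed
    by the points j around which the local frames are given. *)
Definition spinor_frame_bundle :
    @principal_bundle R m M S (lpin rho) (@lpin_val _ _ _ _ rho) :=
  @PrincipalBundle R m M S (lpin rho) (@lpin_val _ _ _ _ rho)
    (fun _ => lpin rho : choiceType) (fun _ a b => (a * b)%g)
    M U (fun j x a => (trans j x * a)%g)
    (fun x a => mulg1 a) (fun x a b c => esym (mulgA a b c))
    U_open (fun x => ex_intro _ x (U_self x)) trans_mul_bij
    (fun j x a b _ => mulgA _ a b) trans_cocycle.

Lemma frame_Ad_exists x (a : lpin rho) :
  exists p : oframe g h x, forall v, p v = q0 x (Ad a v).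
Proof.
have Pl : linear (fun v => q0 x (Ad a v)).
  exact: linear_comp (frame_linear _) (Ad_linear h_quad rho_rep s0_neq0 a).
have PK : cancel (fun v => q0 x (Ad a v))
    (fun w => Ad a^-1%g (frame_inv (q0 x) w)).
  by move=> v; rewrite frameK (AdK h_quad rho_rep s0_neq0).
have P'K : cancel (fun w => Ad a^-1%g (frame_inv (q0 x) w))
    (fun v => q0 x (Ad a v)).
  by move=> w; rewrite (AdVK h_quad rho_rep s0_neq0) frame_invK.
have Pq v : gquad g x (q0 x (Ad a v)) = h v.
  by rewrite frame_isometric (Ad_isometric rho_rep s0_neq0).
by exists (OFrame Pl PK P'K Pq).
Qed.

(** The anticommutator of c v c^-1 with u, applied to the vector s0, is the multiple of
    s0 by the polar form of Ad(c) v and u; a functional which does not vanish at s0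
    extracts this number. *)
Lemma Ad_smooth (N : set M) (c : M -> lpin rho) v u : open N ->
  gsmooth (@lpin_val _ _ _ _ rho) N c ->
  msmooth N (fun x => polar h (Ad (c x) v) u : R^o).
Proof.
move=> oN cs.
have rE w : linfun (rho (clvec h w)) =1 rho (clvec h w).
  exact/linear_linfunE/(rep_linear rho_rep).
have [l [ll ls]] := nonzero_functional s0_neq0.
pose K x := (lpin_val (c x) \o (linfun (rho (clvec h v)) \o (lpin_val (c x))^-1))%VF.
have Ks : hsmooth N K.
  apply: hsmooth_comp => //; apply: hsmooth_comp => //; first exact: hsmooth_cst.
  by apply: endsmooth_inv => // x _; have [] := lpinP (c x).
have KE x s : K x s = rho (clvec h (Ad (c x) v)) s.
  by rewrite !comp_lfunE rE AdP.
pose ru : 'End(S) := linfun (rho (clvec h u)).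
have Ls : hsmooth N (fun x => (K x \o ru) + (ru \o K x))%VF.
  by apply: hsmooth_add => //; apply: hsmooth_comp => //; exact: hsmooth_cst.
pose lL : {scalar S} := HB.pack l (GRing.isLinear.Build _ _ _ _ l ll).
have := csmooth_mul oN (csmooth_cst N (l s0)^-1) (Ls s0 lL).
case=> + _; apply: msmooth_ext => // x _.
rewrite /= add_lfunE (comp_lfunE (K x)) (comp_lfunE ru) !KE !rE.
rewrite (rep_anticomm rho_rep).
by rewrite (linfZ ll) -[_ *: l s0]/(_ * l s0) mulrCA mulVf// mulr1.
Qed.

(** The point a of the fibre over x stands for the spinor frame f0 a, and q0 Ad(a) is
    the isometry along which f0 a is an intertwiner. *)
Variable chi_frame : forall x, lpin rho -> oframe g h x.
Hypothesis chi_frameE : forall x a v, chi_frame x a v = q0 x (Ad a v).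

(** If c is the coordinate of s in the trivialisation j, then the isometry attached to
    s is q_j Ad(c), in which only smooth ingredients occur. *)
Lemma chi_frame_smooth (N : set M) (s : forall x, spinor_frame_bundle x) :
  open N -> smooth_psection N s ->
  forall v : V, smooth_vfield N (fun x => chi_frame x (s x) v).
Proof.
move=> oN ss v; apply: vfield_smooth_local => j Nj.
have [c cs cE] := ss j; pose N' := N `&` U j.
have oN' : open N' by exact: openI.
exists N' => //.
have [e [eps eO]] := orthonormal_exists h_quad (leqnn (\dim {:V}%VS)).
have [qs _ _] := phi_smooth j.
have Xs : smooth_vfield N' (fun x => \sum_(i < \dim {:V}%VS)
    (eps i / 2 * polar h (Ad (c x) v) (e i)) *: q j x (e i)).
  apply: vfield_smooth_sum => // i; apply: vfield_smooth_scale => //.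
    exact: msmooth_mul oN' (msmooth_cst _ (eps i / 2 : R^o)) (Ad_smooth _ _ oN' cs).
  by apply: vfield_smooth_sub (qs (e i)) => x [].
apply: vfield_smooth_ext Xs => // x [Nx jx].
have E : (trans j x * s x)%g = c x := cE x Nx jx.
rewrite chi_frameE -(trans_q _ jx) -(AdM h_quad rho_rep s0_neq0) E.
rewrite [in RHS](orthonormal_expand h_quad (Ad (c x) v) eO).
rewrite (linf_sum (frame_linear _)); apply: eq_bigr => i _.
by rewrite (linfZ (frame_linear _)).
Qed.

Lemma chi_frame_act x (p a : lpin rho) v :
  chi_frame x (p * a)%g v = chi_frame x p (Ad a v).
Proof. by rewrite !chi_frameE (AdM h_quad rho_rep s0_neq0). Qed.

Definition spinor_lpin_structure : lpin_structure g rho :=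
  @LpinStructure R m M g V h S rho spinor_frame_bundle chi_frame
    chi_frame_act chi_frame_smooth.

Local Notation Q := spinor_lpin_structure.

(** This point stands for the frame f0 itself. *)
Definition one_point x : Q x := (1%g : lpin rho).

Lemma f0_inv_exists x : exists f' : Sigma x -> S, cancel (f0 x) f' /\ cancel f' (f0 x).
Proof. by have [_ [f' fK f'K] _] := f0_frame x; exists f'. Qed.

Definition f0_inv x : Sigma x -> S := sval (cid (f0_inv_exists x)).

Lemma f0K x : cancel (f0 x) (@f0_inv x).
Proof. by rewrite /f0_inv; case: cid => f []. Qed.

Lemma f0_invK x : cancel (@f0_inv x) (f0 x).
Proof. by rewrite /f0_inv; case: cid => f []. Qed.

Definition of_spinor x (s : Sigma x) : assoc_bundle Q x :=
  assoc_cls (one_point x) (f0_inv s).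

Definition to_spinor x (c : assoc_bundle Q x) : Sigma x :=
  f0 x (assoc_coord (one_point x) c).

Lemma of_spinorK x : cancel (@of_spinor x) (@to_spinor x).
Proof. by move=> s; rewrite /to_spinor assoc_clsK f0_invK. Qed.

Lemma to_spinorK x : cancel (@to_spinor x) (@of_spinor x).
Proof. by move=> c; rewrite /of_spinor f0K assoc_coordK. Qed.

Lemma of_spinor_linear x : linear (@of_spinor x).
Proof.
have [fl _ _] := f0_frame x.
exact: linear_comp (assoc_cls_linear (one_point x)) (linear_inv (@f0K x) (@f0_invK x) fl).
Qed.

(** The trivialisation j of the associated bundle is the inverse of the local frame
    phi_j; this makes the smoothness of the isomorphism and of its inverse a property
    of phi_j. *)
Lemma assoc_map_of_spinor j x (s : Sigma x) : U j x ->
  phi j x (assoc_map (Q := Q) j (of_spinor s)) = s.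
Proof.
move=> jx; rewrite /of_spinor assoc_mapE// -[RHS](f0_invK s) -(trans_phi _ jx).
by congr (phi j x (lpin_val _ _)); exact: mulg1.
Qed.

Lemma of_spinor_smooth : smooth_hom setT of_spinor.
Proof.
split=> [x _|k j]; first exact: of_spinor_linear.
have [C [Cs CE Cb]] := local_frame_hom j k; pose N := U j `&` tdom k.
have oN : open N by apply: openI => //; exact: tdom_open.
exists (fun x => (C x)^-1%VF).
  have /hsmooth_sub : hsmooth N (fun x => (C x)^-1%VF).
    by apply: hsmooth_inv => // x [jx kx]; exact: Cb.
  by apply=> x [[_ kx] jx].
move=> x _ kx jx s; have [B CB BC] := Cb x jx kx.
rewrite (inv_lfunP CB BC); apply: (can_inj CB); rewrite BC CE//.
by rewrite [tmap j _]/(assoc_map (Q := Q) j (of_spinor s)) assoc_map_of_spinor.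
Qed.

Lemma to_spinor_smooth : smooth_hom setT to_spinor.
Proof.
split=> [x _|j k].
  exact: linear_inv (@of_spinorK x) (@to_spinorK x) (@of_spinor_linear x).
have [C [Cs CE Cb]] := local_frame_hom j k; exists C.
  by apply: hsmooth_sub Cs => x [[_ jx] kx].
move=> x _ jx kx c; rewrite CE//; congr (tmap k _).
by rewrite -{2}(to_spinorK c); exact/esym/assoc_map_of_spinor.
Qed.

(** The associated bundle represents a class by a point b and a vector t, and lets
    Cl(g) act on t through the isometry attached to b. The map f0 b intertwines this
    action on S with the one on Sigma. *)
Lemma of_spinor_tau x a (s : Sigma x) :
  of_spinor (stau a s) = assoc_tau (Q := Q) a (of_spinor s).
Proof.
apply: (can_inj (@to_spinorK x)); rewrite of_spinorK.
rewrite /assoc_tau; have := assoc_cls_repr (of_spinor s : assoc_fib Q x).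
case: (repr _) => b t /= bt.
pose F u := f0 x (lpin_val (b : lpin rho) u).
have toE u : to_spinor (assoc_cls b u) = F u.
  have bE : b = pact (one_point x) (b : lpin rho) by exact/esym/mul1g.
  by rewrite /to_spinor {1}bE assoc_cls_act assoc_clsK.
have Ft : F t = s by rewrite -toE bt of_spinorK.
have [fl _ fE] := f0_frame x; set p := chi_frame x b.
have p'l : linear (frame_inv p) := linear_inv (frameK p) (frame_invK p) (frame_linear p).
have hp w : h (frame_inv p w) = gquad g x w.
  by rewrite -(frame_isometric p) frame_invK.
have Fl : linear F.
  by apply: (linear_comp fl) => c u v; exact: linearP.
rewrite toE -{1}Ft; apply/esym.
apply: (clmap_intertwine rho_rep (stau_rep Sigma x) Fl p'l (frame_invK p) hp) => v u.
by rewrite /F -(AdE (b : lpin rho)) fE /p chi_frameE.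
Qed.

Lemma spinor_bundle_iso : spinor_iso (stau (f := Sigma)) (assoc_tau (Q := Q)).
Proof.
exists of_spinor, to_spinor; split.
- exact: of_spinor_smooth.
- exact: to_spinor_smooth.
- exact: of_spinorK.
- exact: to_spinorK.
- exact: of_spinor_tau.
Qed.

End Assembly.

Theorem theorem3 (R : realType) (m : nat) (m_gt0 : (0 < m)%N)
    (M : manifold R m) (M_connected : connected [set: M]) (g : metric M)
    (V : vectType R) (h : V -> R) (dimV : \dim {:V}%VS = m)
    (h_quad : nondeg_quadform h)
    (local_model : forall x : M,
      exists f : V -> tangent x, is_isometry h (gquad g x) f)
    (S : vectType R[i]) (rho : cl h -> S -> S) (S_spin : spin_space m rho)
    (Sigma : faithful_spinor_bundle g) :
  exists Q : lpin_structure g rho,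
    spinor_iso (stau (f := Sigma)) (assoc_tau (Q := Q)).
Proof.
have rho_rep := dirac_or_cartan_rep (proj1 S_spin).
have [s0 s0_neq0] : exists s0 : S, s0 != 0.
  exists (vpick {:S}%VS); rewrite vpick0 -dimv_eq0 (proj2 S_spin).
  by rewrite expn_eq0.
have frames := spinor_frame_exists dimV h_quad local_model S_spin Sigma.
pose q0 x := sval (cid (frames x)).
pose f0 x := sval (cid (svalP (cid (frames x)))).
have f0_frame x : spinor_frame rho (q0 x) (f0 x) := svalP (cid (svalP (cid (frames x)))).
have local := smooth_spinor_frame_exists dimV h_quad local_model S_spin Sigma.
have /choice[U /choice[q /choice[phi H]]] : forall j, exists U : set M,
  exists q : forall x, oframe g h x, exists phi : forall x, S -> Sigma x,
  [/\ open U, U j & smooth_spinor_frame rho U q phi] by exact: local.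
have U_open j : open (U j) by have [] := H j.
have U_self j : U j j by have [] := H j.
have phi_smooth j : smooth_spinor_frame rho (U j) (q j) (phi j) by have [] := H j.
pose chi x a := sval (cid (frame_Ad_exists h_quad rho_rep s0_neq0 q0 x a)).
have chiE x a v : chi x a v = q0 x (Ad a v) := svalP (cid (frame_Ad_exists _ _ _ q0 x a)) v.
exists (spinor_lpin_structure h_quad rho_rep s0_neq0 f0_frame U_open U_self
          phi_smooth chiE).
exact: spinor_bundle_iso.
Qed.
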